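(* Let $K=\mathbb{F}_2(t)$ and for $y\in K$ let $C_y\subseteq\mathbb{P}^2_K$ be the conic $x_0^2+x_0x_1+yx_1^2=tx_2^2$. For $B\in\{2^M: M\in\mathbb{Z}_{\ge 0}\}$ put \[N(B)=\#\{y\in K: H(y)=B,\ C_y(K)\neq\emptyset\}.\] Then, as $B\to\infty$ through powers of $2$, \[N(B)=\frac{cB^{2}}{(\log B)^{1/2}}+O\!\left(\frac{B^2}{(\log B)^{3/2}}\right),\] where \[c=4\left(\frac{2\log 2}{\pi}\right)^{1/2}\prod_{\omega\in\Omega_K}\left(1-\frac{1}{2^{\deg\omega}}\right)^{1/2}c_\omega,\] with $c_\omega=\frac12\cdot\frac{1-2^{-2}}{1-2^{-1}}=\frac34$ for $\omega\in\{t,t^{-1}\}$ and \[c_\omega=1+\frac12\left(\frac{1}{2^{\deg\omega}}\left(1+\frac{1-2^{-\deg\omega}}{2^{\deg\omega}-1}\right)-\frac{1}{2^{2\deg\omega-1}}\right)\] for $\omega\notin\{t,t^{-1}\}$.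
   Context: $\Omega_K$ is the set of places of $K=\mathbb{F}_2(t)$: each place corresponds either to a monic irreducible polynomial $\omega\in\mathbb{F}_2[t]$ (with $\deg\omega$ its degree) or to the place at infinity $t^{-1}$, with the convention $\deg t^{-1}=1$. For a place $\omega$ with valuation $v_\omega$, the normalized absolute value is $|y|_\omega=2^{-\deg\omega\cdot v_\omega(y)}$. The height of $y\in K$ is $H(y)=\prod_{\omega\in\Omega_K}\max\{1,|y|_\omega\}$. *)

(* Defs.v *)
From HB Require Import structures.
From mathcomp Require Import all_boot all_order all_algebra.
From mathcomp Require Import all_classical all_reals all_analysis.
From mathcomp Require Import fraction.
Set Implicit Arguments. Unset Strict Implicit. Unset Printing Implicit Defensive.
Import Order.TTheory GRing.Theory Num.Theory.
Import numFieldNormedType.Exports.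
Local Open Scope classical_set_scope.
Local Open Scope ring_scope.

Definition Fpoly := {poly 'F_2}.
Definition K := {fraction {poly 'F_2}}.
Definition tK : K := (@FracField.tofrac _ ('X : {poly 'F_2})).

Definition mult (w p : {poly 'F_2}) : nat :=
  (\max_(k < size p | dvdp (w ^+ k) p) k)%N.

Definition numK (y : K) : {poly 'F_2} := (frac (repr y)).1.
Definition denK (y : K) : {poly 'F_2} := (frac (repr y)).2.

Definition is_place_fin (w : {poly 'F_2}) : bool :=
  (w \is monic) && `[< irreducible_poly w >].

Definition degw (w : {poly 'F_2}) : nat := (size w).-1.

Definition val_fin (w : {poly 'F_2}) (y : K) : int :=
  (mult w (numK y))%:Z - (mult w (denK y))%:Z.
Definition val_inf (y : K) : int :=
  (size (denK y))%:Z - (size (numK y))%:Z.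

Definition absv_fin (R : realType) (w : {poly 'F_2}) (y : K) : R :=
  if y == 0 then 0 else (2 : R) ^ (- ((degw w)%:Z * val_fin w y)).
Definition absv_inf (R : realType) (y : K) : R :=
  if y == 0 then 0 else (2 : R) ^ (- val_inf y).

Definition poly_of (n : nat) (f : {ffun 'I_n.+1 -> 'F_2}) : {poly 'F_2} :=
  \poly_(i < n.+1) f (inord i).

Definition Hpart (R : realType) (y : K) (n : nat) : R :=
  Num.max 1 (absv_inf R y) *
  \prod_(f : {ffun 'I_n.+1 -> 'F_2} | is_place_fin (poly_of f))
     Num.max 1 (absv_fin R (poly_of f) y).

(* height H(y) = prod over all places of max(1,|y|_w) (infinite product,
   all but finitely many factors equal 1) *)
Definition height (R : realType) (y : K) : R := limn (Hpart R y).

Definition conic_has_point (y : K) : Prop :=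
  exists x0 x1 x2 : K, (x0, x1, x2) != (0, 0, 0) /\
    x0 ^+ 2 + x0 * x1 + y * x1 ^+ 2 = tK * x2 ^+ 2.

Definition Ncount (R : realType) (M : nat) : R :=
  \sum_(y \in [set y : K | height R y = 2 ^+ M /\ conic_has_point y]) (1 : R).

Definition c_inf (R : realType) : R := 2^-1 * ((1 - 2 ^- 2) / (1 - 2^-1)).
Definition c_fin (R : realType) (w : {poly 'F_2}) : R :=
  if w == 'X then 2^-1 * ((1 - 2 ^- 2) / (1 - 2^-1))
  else 1 + 2^-1 * ((2 ^+ degw w)^-1 *
                     (1 + (1 - (2 ^+ degw w)^-1) / (2 ^+ degw w - 1))
                   - (2 ^+ (2 * degw w - 1))^-1).

Definition cpart (R : realType) (n : nat) : R :=
  ((1 - 2^-1) `^ (2^-1) * c_inf R) *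
  \prod_(f : {ffun 'I_n.+1 -> 'F_2} | is_place_fin (poly_of f))
     ((1 - (2 ^+ degw (poly_of f))^-1) `^ (2^-1) * c_fin R (poly_of f)).

(* Main.v *)
(* Since [t] is not a square, a point of [C_y] has [x1 <> 0], so [C_y(K)] is nonempty iff
   [y = u^2 + u + t v^2] for some [u], [v]: these [y] form a subgroup of [K].  It is compatible with
   partial fractions: the polynomial part of [y] must vanish at [0], the part at [t] is arbitrary,
   and a part [a / w^k] with [w <> t] must satisfy [a(0) = 0].  Hence the number of admissible
   proper fractions with reduced denominator [b] is multiplicative in [b], and its Euler product is
   explicit.  With [x = 4 z] and [q = 2^(deg w)], the counting series is
   [(1 - x)^-1 * prod_w (1 - x^(deg w) / (2 q))].  As [prod_w (1 - x^(deg w) / q) = 1 - x], it equals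
   [(1 - x)^(-1/2) G(x)] where [G = prod_w (1 - X_w/2) (1 - X_w)^(-1/2)], [X_w = x^(deg w) / q].
   Each factor of [G] has nonnegative coefficients and no linear term, so [G] converges at
   [x = 5/4]; the asymptotics follow from those of the central binomial coefficients, given with
   error term by Wallis' product.  Finally [c_w = (1 - q^-2) (1 - 1/(2q)) / (1 - 1/q)] for [w <> t],
   and [prod_w (1 - q^-2) = 1/2]. *)

Require Import Defs.
From HB Require Import structures.
From mathcomp Require Import all_boot all_order all_algebra.
From mathcomp Require Import all_classical all_reals all_analysis.
From mathcomp Require Import fraction.
From mathcomp Require Import ring lra zify.
Set Implicit Arguments. Unset Strict Implicit. Unset Printing Implicit Defensive.
Import Order.TTheory GRing.Theory Num.Theory.
Import numFieldNormedType.Exports.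
Local Open Scope ring_scope.

(** * Polynomials over F_2 *)

(** The hard direction at a place [w <> t] is that [a(0) = 0] suffices. Writing numerators as
    [e^2 + t o^2] reduces [w^k] to [w], and there existence of [u] and [v] comes from a count over
    the finite field, not from a formula. The radius [5/4] meets two constraints. It exceeds [1], so
    the coefficients of [G] decay geometrically and absorb the factor [j (j + 1)] lost when an index
    of the central binomial coefficients is shifted by [j]. It is below [sqrt 2]: local factors
    [1 + O(X_w^2)], bounded by a sum over all [2^m] polynomials of degree [m], require
    [2 (x / 2)^2 < 1]. Power series appear as polynomials modulo [X^(n+1)], and [G] as a finite
    product with two cutoffs: [n] for the degrees of places, [N] for the order of the local factors.
    For [n <= N] the coefficients up to [n] depend on neither. Letting [N] grow gives the closed
    local factors with square roots; letting [n] grow then gives the Euler product. *)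

Lemma F2_cases (c : 'F_2) : c = 0 \/ c = 1.
Proof. by case: c => [[|[|]] // H]; [left|right]; apply/val_inj. Qed.

Lemma F2_sqr (c : 'F_2) : c ^+ 2 = c.
Proof. by case: (F2_cases c) => ->; rewrite ?expr0n ?expr1n. Qed.

Lemma F2_addxx (p : {poly 'F_2}) : p + p = 0.
Proof.
apply/polyP => i; rewrite coefD coef0.
by case: (F2_cases p`_i) => ->; rewrite ?addr0 //; apply/val_inj.
Qed.

Lemma F2_opp (p : {poly 'F_2}) : - p = p.
Proof. by apply/eqP; rewrite eq_sym -addr_eq0 F2_addxx. Qed.

Lemma F2_sqrD (x y : {poly 'F_2}) : (x + y) ^+ 2 = x ^+ 2 + y ^+ 2.
Proof. by rewrite sqrrD mulr2n F2_addxx addr0. Qed.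

Lemma F2_comp_sqr (p : {poly 'F_2}) : p \Po 'X^2 = p ^+ 2.
Proof.
elim/poly_ind: p => [|p c IH]; first by rewrite comp_poly0 expr0n.
rewrite comp_polyD comp_polyM comp_polyX comp_polyC IH F2_sqrD exprMn.
by rewrite -rmorphXn /= F2_sqr.
Qed.

Lemma F2_even_odd (p : {poly 'F_2}) : p = even_poly p ^+ 2 + 'X * odd_poly p ^+ 2.
Proof. by rewrite -{1}[p]poly_even_odd !F2_comp_sqr (mulrC 'X). Qed.

Lemma F2_size_sqr (p : {poly 'F_2}) : (size (p ^+ 2) = (size p).*2.-1)%N.
Proof.
have [->|p0] := eqVneq p 0; first by rewrite expr0n /= size_poly0.
by rewrite expr2 size_mul // addnn.
Qed.

Local Notation tofracK := (@FracField.tofrac {poly 'F_2}).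

Lemma denK_neq0 (y : K) : denK y != 0.
Proof. by rewrite /denK; case: (repr y). Qed.

Lemma K_numden (y : K) : y = tofracK (numK y) / tofracK (denK y).
Proof.
have d0 := denK_neq0 y.
have dF : tofracK (denK y) != 0 by rewrite tofrac_eq0.
apply: (mulIf dF); rewrite divfK //.
rewrite /denK /numK in d0 *.
rewrite -[X in X * _ = _](reprK y); unlock FracField.tofrac.
rewrite -[LHS]FracField.pi_mul; apply/eqmodP => /=.
by rewrite /FracField.equivf /FracField.mulf !numden_Ratio ?(oner_eq0, mulf_neq0, mul1r, mulr1) // mulrC.
Qed.

Definition poly_size (p : {poly 'F_2}) : nat := size p.

(* The sizes in a goal may be elaborated through distinct ring structures on ['F_2], which [lia] takes for distinct atoms. *)
Ltac size_lia := repeat match goal with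
  | |- context [@size ?T (@polyseq ?R ?p)] =>
      change (@size T (@polyseq R p)) with (poly_size p)
  | H : context [@size ?T (@polyseq ?R ?p)] |- _ =>
      change (@size T (@polyseq R p)) with (poly_size p) in H
  end; lia.

(* The field [K] enters only through the embedding of polynomials; keeping it abstract stops
   conversion from unfolding the quotient that defines [{fraction _}]. *)
Section ArtinSchreier.
Variables (L : fieldType) (iota : {rmorphism {poly 'F_2} -> L}).
Hypothesis iota_inj : injective iota.
Hypothesis iota_frac : forall z : L, exists a b : {poly 'F_2}, b != 0 /\ z = iota a / iota b.
Local Notation "p %:F" := (iota p).
Local Notation t := (iota 'X).

Lemma iota_eq (p q : {poly 'F_2}) : (p%:F == q%:F) = (p == q).
Proof. by rewrite inj_eq. Qed.

Lemma iota_eq0 (p : {poly 'F_2}) : (p%:F == 0) = (p == 0).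
Proof. by rewrite -(rmorph0 iota) iota_eq. Qed.

Lemma addxx (y : L) : y + y = 0.
Proof.
have -> : y + y = (1 + 1) * y by rewrite mulrDl mul1r.
by rewrite -(rmorph1 iota) -rmorphD F2_addxx rmorph0 mul0r.
Qed.

Lemma oppxx (y : L) : - y = y.
Proof. by apply/eqP; rewrite eq_sym -addr_eq0 addxx. Qed.

Lemma sqrD_char2 (x y : L) : (x + y) ^+ 2 = x ^+ 2 + y ^+ 2.
Proof. by rewrite sqrrD mulr2n addxx addr0. Qed.

(* The affine form ([x1 = 1]) of the solvability of [C_y]. *)
Definition AS (y : L) : Prop := exists u v : L, y = u ^+ 2 + u + t * v ^+ 2.

(** Clearing denominators gives [a^2 = t b^2] with [b] nonzero, and the right side has odd
    degree. *)
Lemma t_nonsquare (u v : L) : u ^+ 2 = t * v ^+ 2 -> u = 0 /\ v = 0.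
Proof.
move=> uv.
have tK0 : t != 0 by rewrite iota_eq0 polyX_eq0.
suff v0 : v = 0.
  by split=> //; move: uv; rewrite v0 expr0n mulr0 => /eqP; rewrite sqrf_eq0 => /eqP.
apply/eqP/negP => /negP v0.
have [a [b [b0 e]]] := iota_frac (u / v).
have bF : b%:F != 0 by rewrite iota_eq0.
have E : a%:F ^+ 2 = t * b%:F ^+ 2.
  have -> : a%:F = u / v * b%:F by rewrite e divfK.
  by rewrite exprMn expr_div_n uv mulfK // sqrf_eq0.
move: E; rewrite -!rmorphXn -rmorphM => /eqP; rewrite iota_eq => /eqP E.
have := congr1 (fun p : {poly 'F_2} => size p) E.
rewrite mulrC size_mulX ?expf_neq0 // !F2_size_sqr.
have : (0 < size b)%N by rewrite lt0n size_poly_eq0.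
lia.
Qed.

Lemma conic_AS (y : L) : (exists x0 x1 x2 : L, (x0, x1, x2) != (0, 0, 0) /\
    x0 ^+ 2 + x0 * x1 + y * x1 ^+ 2 = t * x2 ^+ 2) <-> AS y.
Proof.
split=> [[x0 [x1 [x2 [nz e]]]]|[u [v ->]]]; last first.
  exists u, 1, v; split; first by rewrite !xpair_eqE oner_eq0 andbF.
  rewrite expr1n !mulr1.
  rewrite addrA -[RHS]add0r; congr (_ + _).
  by rewrite addxx.
have [x10|x10] := eqVneq x1 0.
  move: e nz; rewrite x10 !(expr0n, mulr0) !addr0 => /t_nonsquare [-> ->].
  by rewrite eqxx.
exists (x0 / x1), (x2 / x1).
have -> : y = (y * x1 ^+ 2) / x1 ^+ 2 by rewrite mulfK // sqrf_eq0.
have -> : y * x1 ^+ 2 = t * x2 ^+ 2 - (x0 ^+ 2 + x0 * x1) by rewrite -e addrC addKr.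
rewrite oppxx; field.
by rewrite x10.
Qed.

Lemma AS0 : AS 0.
Proof. by exists 0, 0; rewrite expr0n mulr0 !addr0. Qed.

Lemma AS_add (y z : L) : AS y -> AS z -> AS (y + z).
Proof.
move=> [u [v ->]] [u' [v' ->]]; exists (u + u'), (v + v').
rewrite !sqrD_char2; ring.
Qed.

Lemma AS_addr (y z : L) : AS y -> AS (y + z) -> AS z.
Proof. by move=> hy /(AS_add hy); rewrite addrA addxx add0r. Qed.

(* Modulo the subgroup [AS], an element of [L = L^2 + t L^2] is congruent to its first component. *)
Lemma AS_cartier (a b : L) : AS (a ^+ 2 + t * b ^+ 2) <-> AS a.
Proof.
have h : AS (a ^+ 2 + a + t * b ^+ 2) by exists a, b.
split=> ha.
  apply: AS_addr ha _.
  by rewrite addrAC.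
apply: AS_addr ha _.
by rewrite addrA (addrC a).
Qed.
Lemma t_neq0 : t != 0.
Proof. by rewrite iota_eq0 polyX_eq0. Qed.

(** An odd power is [t] times a square, so [u = 0] works; an even power is a square, and
    [AS_cartier] passes to its root. *)
Lemma AS_tpow (i : nat) : (0 < i)%N -> AS (t ^+ i).
Proof.
elim/ltn_ind: i => i IH i0.
have := odd_double_half i; case: (odd i) => /=; first move=> <-.
  exists 0, (t ^+ i./2); rewrite expr0n !add0r -exprM add1n exprS.
  by rewrite muln2.
move=> i2; rewrite -i2 add0n -muln2 exprM.
have : AS ((t ^+ i./2) ^+ 2 + t * 0 ^+ 2) by apply/AS_cartier/IH; lia.
by rewrite expr0n mulr0 addr0.
Qed.

Lemma AS_tinv (i : nat) : (0 < i)%N -> AS (t^-1 ^+ i).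
Proof.
elim/ltn_ind: i => i IH i0.
have := odd_double_half i; case: (odd i) => /=; first move=> <-.
  (* One more than for positive powers: [t^-(2j+1) = t (t^-(j+1))^2]. *)
  exists 0, (t^-1 ^+ i./2.+1); rewrite expr0n !add0r -exprM add1n.
  by rewrite muln2 doubleS [in RHS]exprS mulrA divff ?t_neq0 // mul1r.
move=> i2; rewrite -i2 add0n -muln2 exprM.
have : AS ((t^-1 ^+ i./2) ^+ 2 + t * 0 ^+ 2) by apply/AS_cartier/IH; lia.
by rewrite expr0n mulr0 addr0.
Qed.

Lemma AS_lin (n : nat) (c : 'I_n -> 'F_2) (y : 'I_n -> L) :
  (forall i, c i != 0 -> AS (y i)) -> AS (\sum_i (c i)%:P%:F * y i).
Proof.
move=> h; elim/big_ind: _ => [||i _]; [exact: AS0|exact: AS_add|].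
case: (F2_cases (c i)) (h i) => -> hi; first by rewrite !rmorph0 mul0r; exact: AS0.
by rewrite !rmorph1 mul1r; apply: hi; rewrite oner_eq0.
Qed.

(** * Polynomial parts and fractions vanishing at infinity *)

Definition proper (z : L) := exists a b : {poly 'F_2},
  (size a < size b)%N /\ z = a%:F / b%:F.

Lemma gt_size_neq0 (a b : {poly 'F_2}) : (size a < size b)%N -> b != 0.
Proof. by case: eqVneq => // ->; rewrite size_poly0. Qed.

Lemma proper_add (y z : L) : proper y -> proper z -> proper (y + z).
Proof.
move=> [a [b [ab ->]]] [c [d [cd ->]]].
have [b0 d0] := (gt_size_neq0 ab, gt_size_neq0 cd).
exists (a * d + c * b), (b * d); split; last first.
  by rewrite addf_div ?iota_eq0 // -!rmorphM -rmorphD.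
rewrite size_mul //; apply: (leq_ltn_trans (size_polyD _ _)).
rewrite gtn_max; apply/andP; split; apply: (leq_ltn_trans (size_polyMleq _ _)); size_lia.
Qed.

Lemma proper_sqr (z : L) : proper z -> proper (z ^+ 2).
Proof.
move=> [a [b [ab ->]]]; exists (a ^+ 2), (b ^+ 2); split; last first.
  by rewrite expr_div_n -!rmorphXn.
rewrite !F2_size_sqr; lia.
Qed.

(** Squaring doubles the order of vanishing at infinity, and the factor [t] costs only one. *)
Lemma proper_tsqr (z : L) : proper z -> proper (t * z ^+ 2).
Proof.
move=> [a [b [ab ->]]]; exists ('X * a ^+ 2), (b ^+ 2); split; last first.
  by rewrite expr_div_n mulrA -!rmorphXn -rmorphM.
have [->|a0] := eqVneq a 0.
  rewrite expr0n mulr0 size_poly0 F2_size_sqr; size_lia.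
rewrite mulrC size_mulX ?expf_neq0 // !F2_size_sqr.
have := size_poly_eq0 a; rewrite (negPf a0); size_lia.
Qed.

Lemma proper_AS (u v : L) : proper u -> proper v ->
  proper (u ^+ 2 + u + t * v ^+ 2).
Proof.
by move=> hu hv; do ?apply: proper_add => //; [exact: proper_sqr|exact: proper_tsqr].
Qed.

Lemma proper_poly (p : {poly 'F_2}) : proper p%:F -> p = 0.
Proof.
move=> [a [b [ab e]]]; have b0 := gt_size_neq0 ab.
have /eqP : p%:F * b%:F = a%:F by rewrite e divfK // iota_eq0.
rewrite -rmorphM iota_eq => /eqP pb.
apply/eqP/negP => /negP p0; move: ab; rewrite -pb size_mul //.
by have := size_poly_eq0 p; rewrite (negPf p0); size_lia.
Qed.

Lemma poly_proper_decomp (z : L) : exists (p : {poly 'F_2}) (r : L), z = p%:F + r /\ proper r.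
Proof.
have [a [b [b0 e]]] := iota_frac z.
exists (a %/ b), ((a %% b)%:F / b%:F); split; last first.
  by exists (a %% b), b; rewrite ltn_modp.
by rewrite e {1}(divp_eq a b) rmorphD rmorphM mulrDl mulfK // iota_eq0.
Qed.

(** Split [u] and [v] into polynomial and proper parts. Then [p] plus the value of [u^2 + u + t v^2]
    on the polynomial parts is a polynomial and proper, hence zero; at [0] that value is
    [c^2 + c = 0] with [c] in ['F_2]. *)
Lemma AS_poly_proper (p : {poly 'F_2}) (r : L) :
  proper r -> AS (p%:F + r) -> p`_0 = 0.
Proof.
move=> hr [u [v e]].
have [pu [ru [eu hu]]] := poly_proper_decomp u; have [pv [rv [ev hv]]] := poly_proper_decomp v.
have : proper ((p + (pu ^+ 2 + pu + 'X * pv ^+ 2))%:F).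
  have -> : (p + (pu ^+ 2 + pu + 'X * pv ^+ 2))%:F
     = r + (ru ^+ 2 + ru + t * rv ^+ 2).
    have ep : p%:F = (u ^+ 2 + u + t * v ^+ 2) + r by rewrite -e -addrA addxx addr0.
    rewrite rmorphD /= ep !rmorphD /=.
    rewrite eu ev !sqrD_char2 (rmorphM iota 'X) !rmorphXn /=.
    have := addxx (pu%:F ^+ 2 + pu%:F + t * pv%:F ^+ 2).
    set X := (X in X = 0) => X0; rewrite -[RHS]addr0 -X0 /X.
    ring.
  by apply: proper_add => //; exact: proper_AS.
move=> /proper_poly /eqP; rewrite addr_eq0 F2_opp => /eqP ->.
rewrite !coefD coefXM addr0 expr2 coefM big_ord1 subn0 -expr2 F2_sqr.
by case: (F2_cases pu`_0) => ->; apply/val_inj.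
Qed.

Lemma AS_poly (p : {poly 'F_2}) : p`_0 = 0 -> AS p%:F.
Proof.
move=> p0; rewrite -[p]coefK poly_def rmorph_sum /=.
under eq_bigr do rewrite -mul_polyC rmorphM rmorphXn /=.
apply: AS_lin => i; have [i0|/AS_tpow //] := posnP i.
by rewrite i0 p0 eqxx.
Qed.

Lemma AS_Xpow (a : {poly 'F_2}) (k : nat) : (size a <= k)%N -> AS (a%:F / ('X ^+ k)%:F).
Proof.
move=> ak; have -> : a = \poly_(i < k) a`_i.
  apply/polyP => i; rewrite coef_poly; case: ltnP => // ki.
  by rewrite nth_default // (leq_trans ak).
rewrite poly_def rmorph_sum mulr_suml /=.
under eq_bigr do rewrite -mul_polyC rmorphM rmorphXn /= -mulrA.
apply: AS_lin => i _; rewrite rmorphXn /=.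
have -> : t ^+ i / t ^+ k = t^-1 ^+ (k - i).
  rewrite -[X in _ / _ ^+ X](subnKC (ltnW (ltn_ord i))) exprD invfM mulrA divff ?expf_neq0 ?t_neq0 //.
  by rewrite mul1r exprVn.
by apply: AS_tinv; rewrite subn_gt0.
Qed.

(** For nonzero [b], [over b] is the ring [F_2[t, 1/b]] and [coprime_to b] the ring of fractions
    regular at all divisors of [b]. They meet in the polynomials, so a proper element of both is
    zero. *)
Definition over (b : {poly 'F_2}) (z : L) := exists (N : nat) (a : {poly 'F_2}),
  z = a%:F / (b ^+ N)%:F.

Definition coprime_to (b : {poly 'F_2}) (z : L) := exists a c : {poly 'F_2},
  [/\ c != 0, coprimep c b & z = a%:F / c%:F].

Lemma over_poly b p : over b p%:F.
Proof. by exists 0%N, p; rewrite expr0 rmorph1 divr1. Qed.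

Lemma coprime_to_poly b p : coprime_to b p%:F.
Proof. by exists p, 1; rewrite oner_eq0 coprime1p rmorph1 divr1. Qed.

Lemma over_add b y z : b != 0 -> over b y -> over b z -> over b (y + z).
Proof.
move=> b0 [N [a ->]] [M [c ->]]; exists (N + M)%N, (a * b ^+ M + c * b ^+ N).
by rewrite addf_div ?iota_eq0 ?expf_neq0 // -!rmorphM -rmorphD exprD.
Qed.

Lemma over_mul b y z : over b y -> over b z -> over b (y * z).
Proof.
move=> [N [a ->]] [M [c ->]]; exists (N + M)%N, (a * c).
by rewrite exprD !rmorphM mulf_div.
Qed.

Lemma coprime_to_add b y z : coprime_to b y -> coprime_to b z -> coprime_to b (y + z).
Proof.
move=> [a [c [c0 cb ->]]] [a' [c' [c'0 c'b ->]]]; exists (a * c' + a' * c), (c * c').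
rewrite mulf_neq0 // coprimepMl cb c'b; split=> //.
by rewrite addf_div ?iota_eq0 // -!rmorphM -rmorphD.
Qed.

Lemma coprime_to_mul b y z : coprime_to b y -> coprime_to b z -> coprime_to b (y * z).
Proof.
move=> [a [c [c0 cb ->]]] [a' [c' [c'0 c'b ->]]]; exists (a * a'), (c * c').
rewrite mulf_neq0 // coprimepMl cb c'b; split=> //.
by rewrite !rmorphM mulf_div.
Qed.

Lemma over_AS b u v : b != 0 -> over b u -> over b v -> over b (u ^+ 2 + u + t * v ^+ 2).
Proof.
move=> b0 hu hv; have ht := over_poly b 'X.
by rewrite !expr2; do ?[apply: over_add => //|apply: over_mul => //].
Qed.

Lemma coprime_to_AS b u v : coprime_to b u -> coprime_to b v ->
  coprime_to b (u ^+ 2 + u + t * v ^+ 2).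
Proof.
move=> hu hv; have ht := coprime_to_poly b 'X.
by rewrite !expr2; do ?[apply: coprime_to_add => //|apply: coprime_to_mul => //].
Qed.

Lemma over_coprime_proper b z : b != 0 -> over b z -> coprime_to b z -> proper z -> z = 0.
Proof.
move=> b0 [N [a ea]] [d [c [c0 cb ec]]] pz.
have bN0 : (b ^+ N)%:F != 0 by rewrite iota_eq0 expf_neq0.
have cF : c%:F != 0 by rewrite iota_eq0.
have /eqP : a%:F * c%:F = d%:F * (b ^+ N)%:F.
  have -> : a%:F = z * (b ^+ N)%:F by rewrite ea divfK.
  have -> : d%:F = z * c%:F by rewrite ec divfK.
  by rewrite mulrAC.
rewrite -!rmorphM iota_eq => /eqP e.
have /dvdpP [q eq] : b ^+ N %| a.
  by rewrite -(@Gauss_dvdpl _ a c) ?e ?dvdp_mull // coprimep_expl // coprimep_sym.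
have ez : z = q%:F by rewrite ea eq rmorphM mulfK.
by rewrite ez (proper_poly (p := q)) ?rmorph0 // -ez.
Qed.

(** The gcd with [b] is divided out repeatedly; each round removes a nonconstant factor and costs
    one more power of [b]. *)
Lemma coprime_part (b e : {poly 'F_2}) : e != 0 ->
  exists e1 e2 N, [/\ e = e1 * e2, e1 %| b ^+ N & coprimep e2 b].
Proof.
move: {2}(size e) (leqnn (size e)) => n.
elim: n e => [|n IH] e; first by rewrite leqn0 size_poly_eq0 => ->.
move=> sn e0; have [cb|ncb] := boolP (coprimep e b).
  by exists 1, e, 0%N; rewrite mul1r dvd1p.
have /dvdpP [e' ee'] := dvdp_gcdl e b.
have g0 : gcdp e b != 0 by rewrite gcdp_eq0 (negPf e0).
have e'0 : e' != 0 by apply: contraNneq e0 => h; rewrite ee' h mul0r.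
have se' : (size e' <= n)%N.
  move: sn; rewrite {1}ee' size_mul //.
  have : (size (gcdp e b) != 1)%N by rewrite -coprimep_def.
  have := size_poly_eq0 (gcdp e b); rewrite (negPf g0); size_lia.
have [e1 [e2 [N [ee1 d1 c2]]]] := IH _ se' e'0.
exists (gcdp e b * e1), e2, N.+1; split=> //.
  by rewrite {1}ee' ee1 mulrC mulrA.
by rewrite exprS dvdp_mul // dvdp_gcdr.
Qed.

Lemma split_over b z : b != 0 -> exists z1 z2,
  [/\ z = z1 + z2, over b z1, proper z1 & coprime_to b z2].
Proof.
move=> b0; have [c [e [e0 ez]]] := iota_frac z.
have [e1 [e2 [N [ee /dvdpP [g eg] c2]]]] := coprime_part b e0.
have bN0 : b ^+ N != 0 by rewrite expf_neq0.
have := e0; rewrite {1}ee mulf_eq0 => /norP [e10 e20].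
have g0 : g != 0 by apply: contraNneq bN0 => h; rewrite eg h mul0r.
have /Bezout_eq1_coprimepP [[u v] /= uv] : coprimep (b ^+ N) e2.
  by rewrite coprimep_expl // coprimep_sym.
(* The remainder keeps the first part proper; the quotient is a polynomial and moves to the part
   regular at [b]. *)
pose r := (c * g * v) %% b ^+ N; pose q := (c * g * v) %/ b ^+ N.
exists (r%:F / (b ^+ N)%:F), ((c * g * u + q * e2)%:F / e2%:F); split.
- rewrite addf_div ?iota_eq0 // -!rmorphM -rmorphD.
  have -> : r * e2 + (c * g * u + q * e2) * b ^+ N = c * g.
    transitivity ((q * b ^+ N + r) * e2 + c * g * u * b ^+ N); first by ring.
    rewrite -divp_eq; transitivity (c * g * (u * b ^+ N + v * e2)); first by ring.
    by rewrite uv mulr1.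
  rewrite ez ee eg !rmorphM.
  by field; rewrite !iota_eq0 e10 e20 g0.
- by exists N, r.
- by exists r, (b ^+ N); rewrite ltn_modp.
- by exists (c * g * u + q * e2), e2.
Qed.

(* What is regular at [b], and proper with poles at [b] only, vanishes; so the components of [u] and [v]
   with poles at [b] alone already represent [y]. *)
Lemma AS_split b y z : b != 0 -> over b y -> proper y -> coprime_to b z ->
  AS (y + z) -> exists u v, [/\ over b u, over b v, proper u, proper v
    & y = u ^+ 2 + u + t * v ^+ 2].
Proof.
move=> b0 oy py cz [u [v e]].
have [u1 [u2 [eu ou pu cu]]] := split_over u b0.
have [v1 [v2 [ev ov pv cv]]] := split_over v b0.
exists u1, v1; split=> //.
set w := u1 ^+ 2 + _ + _; set w' := u2 ^+ 2 + u2 + t * v2 ^+ 2.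
have E : y + w = z + w'.
  apply/eqP; rewrite -subr_eq0 oppxx addrACA e eu ev !sqrD_char2.
  apply/eqP; rewrite -[RHS](addxx (w + w')) /w /w'; ring.
have : y + w = 0.
  apply: (over_coprime_proper b0).
  - by apply: over_add => //; exact: over_AS.
  - by rewrite E; apply: coprime_to_add => //; exact: coprime_to_AS.
  - by apply: proper_add => //; exact: proper_AS.
by move/eqP; rewrite addr_eq0 oppxx => /eqP.
Qed.

End ArtinSchreier.

(** * The Cartier operator on proper fractions *)

Lemma F2_neq0 (c : 'F_2) : c != 0 -> c = 1.
Proof. by case: (F2_cases c) => ->. Qed.

Lemma F2_monic (p : {poly 'F_2}) : p != 0 -> p \is monic.
Proof. by rewrite -lead_coef_eq0 => /F2_neq0 h; apply/monicP. Qed.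

Lemma F2_eqp (p q : {poly 'F_2}) : p %= q -> p = q.
Proof.
move=> h; have [p0|p0] := eqVneq p 0.
  by move: h; rewrite p0 eqp_sym eqp0 => /eqP.
have q0 : q != 0 by apply: contraTneq h => ->; rewrite eqp0.
move/eqp_eq: h; have /monicP -> := F2_monic p0; have /monicP -> := F2_monic q0.
by rewrite !scale1r.
Qed.

Lemma irredp_coef0 (w : {poly 'F_2}) : irreducible_poly w -> w != 'X -> w`_0 = 1.
Proof.
move=> [w1 wi] wX; apply: F2_neq0; apply: contraNneq wX => w0.
have Xw : 'X %| w by rewrite -['X]subr0 -(polyC0) dvdp_XsubCl; apply/rootP; rewrite horner_coef0.
by apply/eqP/esym/F2_eqp/wi => //; rewrite size_polyX.
Qed.

Lemma F2_deriv_sqr (p : {poly 'F_2}) : (p ^+ 2)^`() = 0.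
Proof. by rewrite deriv_exp mulr2n F2_addxx. Qed.

Lemma irredp_coprime (w p : {poly 'F_2}) : irreducible_poly w -> ~~ (w %| p) -> coprimep w p.
Proof.
move=> [w1 wi] nwp; rewrite coprimep_def; apply/negPn/negP => /wi /(_ (dvdp_gcdl _ _)) g.
by move: nwp; rewrite -(eqp_dvdl _ g) dvdp_gcdr.
Qed.

(* Differentiating [h w = h^2 + X B^2] gives [(h w)' = B^2], so [w] divides [h (h + X w')]. *)
Lemma cartier_fixed (w h : {poly 'F_2}) : irreducible_poly w -> (size h < size w)%N ->
  even_poly (h * w) = h -> h = 0 \/ h = ('X * w^`()) %% w.
Proof.
move=> wi sh e; have e2 := F2_even_odd (h * w).
set B := odd_poly _ in e2; rewrite e in e2.
have dB : (h * w)^`() = B ^+ 2.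
  by rewrite {1}e2 derivD F2_deriv_sqr derivM derivX F2_deriv_sqr mulr0 mul1r add0r addr0.
have E : h * (h + 'X * w^`()) = w * (h + 'X * h^`()).
  move: e2; rewrite -dB derivM => e2.
  have -> : h * (h + 'X * w^`()) =
    (h ^+ 2 + 'X * (h^`() * w + h * w^`())) + 'X * h^`() * w + (- ('X * h^`() * w)) *+ 2 by ring.
  by rewrite -e2 mulr2n F2_addxx; ring.
have : w %| h * (h + 'X * w^`()) by rewrite E dvdp_mulr.
have [hw|] := boolP (w %| h).
  move=> _; left; apply/eqP; apply: contraTT sh => h0.
  by rewrite -leqNgt dvdp_leq.
move=> nwh; rewrite Gauss_dvdpr ?irredp_coprime // => /modp_eq0; rewrite modpD (modp_small sh) => /eqP.
by rewrite addr_eq0 F2_opp => /eqP; right.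
Qed.

Lemma card_le_fibers (T : finType) (f : T -> T) (k : nat) :
  (forall y, #|[set x | f x == y]| <= k)%N -> (#|T| <= #|f @: [set: T]| * k)%N.
Proof.
move=> fk; rewrite -[X in (X <= _)%N]sum1_card (partition_big f (mem (f @: [set: T]))) /=; last first.
  by move=> i _; apply: imset_f; rewrite inE.
apply: (@leq_trans (\sum_(j in f @: [set: T]) k)%N); last by rewrite sum_nat_const.
apply: leq_sum => y _.
by rewrite sum1dep_card; apply: fk.
Qed.

(* The kernel of [h |-> h + even_poly (h w)] has at most two elements, so its image has index at most
   two, and it lies in the index-two subgroup of polynomials vanishing at [0]. *)
Lemma cartier_surj (w a : {poly 'F_2}) : irreducible_poly w -> w`_0 = 1 ->
  (size a < size w)%N -> a`_0 = 0 ->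
  exists h : {poly 'F_2}, a = h + even_poly (h * w).
Proof.
move=> wi w0 sa a0; have [w1 _] := wi.
pose d := (size w).-1.
have sw : size w = d.+1 by rewrite /d; size_lia.
have d0 : (0 < d)%N by rewrite /d; size_lia.
rewrite sw ltnS in sa.
pose psi (v : 'rV['F_2]_d) : 'rV['F_2]_d :=
  poly_rV (rVpoly v + even_poly (rVpoly v * w)).
have sz (v : 'rV['F_2]_d) : (size (rVpoly v) <= d)%N by exact: size_poly.
have psiE v : rVpoly (psi v) = rVpoly v + even_poly (rVpoly v * w).
  rewrite /psi poly_rV_K //; apply: leq_trans (size_polyD _ _) _.
  rewrite geq_max sz /=; apply: leq_trans (size_even_poly _) _.
  have := size_polyMleq (rVpoly v) w; have := sz v; rewrite sw.
  size_lia.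
have psiB u v : psi (u - v) = psi u - psi v.
  apply: (can_inj (@rVpolyK _ _)); rewrite [RHS]linearB /= !psiE linearB /=.
  by rewrite !F2_opp mulrDl even_polyD addrACA.
have ker v : psi v = 0 -> v = 0 \/ v = poly_rV (('X * w^`()) %% w).
  move=> /(congr1 (@rVpoly _ _)); rewrite psiE linear0 => /eqP.
  rewrite addr_eq0 F2_opp eq_sym => /eqP h.
  case: (cartier_fixed wi _ h) => [|e|e]; first by rewrite sw ltnS.
    by left; apply: (can_inj (@rVpolyK _ _)); rewrite linear0.
  by right; apply: (can_inj (@rVpolyK _ _)); rewrite poly_rV_K -e.
have fib y : (#|[set x | psi x == y]| <= 2)%N.
  have [->|[x0]] := set_0Vmem [set x | psi x == y]; first by rewrite cards0.
  rewrite inE => /eqP hx0.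
  apply: (@leq_trans #|[set x0; x0 + poly_rV (('X * w^`()) %% w)]|); last first.
    by rewrite cards2; case: (_ != _).
  apply: subset_leq_card. apply/fintype.subsetP => x; rewrite !inE => /eqP hx.
  have /ker [/eqP|/eqP] : psi (x - x0) = 0 by rewrite psiB hx hx0 subrr.
    by rewrite subr_eq0 => ->.
  by rewrite subr_eq addrC => ->; rewrite orbT.
pose V := [set v : 'rV['F_2]_d | (rVpoly v)`_0 == 0].
(* Since [w(0) = 1], [h] and [even_poly (h * w)] have the same constant term, and their sum vanishes
   at [0]. *)
have imV : psi @: [set: _] \subset V.
  apply/fintype.subsetP => _ /imsetP [v _ ->]; rewrite inE psiE coefD coef_even_poly.
  rewrite coef0M w0 mulr1; apply/eqP.
  by case: (F2_cases (rVpoly v)`_0) => ->; apply/val_inj.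
(* Adding the constant [1] maps [V] into its complement. *)
have cV : (#|V| * 2 <= #|'rV['F_2]_d|)%N.
  pose e0 : 'rV['F_2]_d := poly_rV 1.
  have e0E : rVpoly e0 = 1 by rewrite poly_rV_K // size_poly1.
  pose V' := [set v + e0 | v in V].
  have cV' : #|V'| = #|V| by apply: card_imset; apply: addIr.
  have dV : [disjoint V & V'].
    apply/pred0P => v /=; apply/negP => /andP [hv /imsetP [u hu e]].
    by move: hv hu; rewrite !inE e linearD /= e0E coefD coef1 => /eqP h1 /eqP h2; move: h1; rewrite h2.
  rewrite muln2 -addnn -{2}cV' -cardsUI (disjoint_setI0 dV) cards0 addn0.
  exact: max_card.
have := card_le_fibers fib => cI.
have VE : psi @: [set: _] = V.
  by apply/eqP; rewrite eqEcard imV /= -(leq_pmul2r (m := 2)) // (leq_trans cV).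
have : poly_rV a \in V by rewrite inE poly_rV_K // a0.
rewrite -VE => /imsetP [v _ e]; exists (rVpoly v).
by rewrite -psiE -e poly_rV_K.
Qed.

(** * Local criteria for membership in [AS] *)

Section LocalCriteria.
Variables (L : fieldType) (iota : {rmorphism {poly 'F_2} -> L}).
Hypothesis iota_inj : injective iota.
Hypothesis iota_frac : forall z : L, exists a b : {poly 'F_2}, b != 0 /\ z = iota a / iota b.
Local Notation "p %:F" := (iota p).
Local Notation t := (iota 'X).
Local Notation AS := (@AS L iota).

Lemma F2_add_sqr (c : 'F_2) : c ^+ 2 + c = 0.
Proof. by case: (F2_cases c) => ->; apply/val_inj. Qed.

(** By [AS_split] the denominators of [u] and [v] can be taken to be powers of [b], so both are
    regular at [0]; evaluating there leaves [c^2 + c = 0]. *)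
Lemma AS_coef0 (a b : {poly 'F_2}) : b`_0 = 1 -> (size a < size b)%N ->
  AS (a%:F / b%:F) -> a`_0 = 0.
Proof.
move=> b1 sab h; have b0 := gt_size_neq0 sab.
have oz : over iota b (a%:F / b%:F) by exists 1%N, a; rewrite expr1.
have pz : proper iota (a%:F / b%:F) by exists a, b.
have cz : coprime_to iota b 0 by rewrite -(rmorph0 iota); exact: coprime_to_poly.
have := AS_split iota_inj iota_frac b0 oz pz cz; rewrite addr0.
move=> /(_ h) [u [v [[N [c eu]] [M [d ev]] _ _ e]]].
have /eqP : (a * b ^+ (N + N + M + M))%:F =
  (c ^+ 2 * b ^+ (M + M).+1 + c * b ^+ (N + M + M).+1 + 'X * d ^+ 2 * b ^+ (N + N).+1)%:F.
  have bF : b%:F != 0 by rewrite iota_eq0.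
  have -> : (a * b ^+ (N + N + M + M))%:F =
      (a%:F / b%:F) * b%:F ^+ (N + N + M + M).+1.
    by rewrite rmorphM rmorphXn /= exprS mulrA divfK.
  rewrite e eu ev !(rmorphD, rmorphM, rmorphXn) /= !exprS !exprD !expr0 !mulr1.
  field; by rewrite !expf_neq0.
rewrite iota_eq // => /eqP E.
have ev0 (p : {poly 'F_2}) : p`_0 = p.[0] by rewrite horner_coef0.
move: E => /(congr1 (fun p : {poly 'F_2} => p.[0])).
rewrite !(hornerD, hornerM, horner_exp, hornerX) mul0r mul0r addr0.
by rewrite -!ev0 b1 !expr1n !mulr1 F2_add_sqr.
Qed.

(** Take [a = h + p] from [cartier_surj], with [h w = p^2 + t q^2]. Dividing by [w^2] gives
    [h / w = (p / w)^2 + t (q / w)^2], so [u = p / w] and [v = q / w]. *)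
Lemma AS_irred (w a : {poly 'F_2}) : irreducible_poly w -> w`_0 = 1 ->
  (size a < size w)%N -> a`_0 = 0 -> AS (a%:F / w%:F).
Proof.
move=> wi w0 sa a0; have [h e] := cartier_surj wi w0 sa a0.
have wF : w%:F != 0 by rewrite iota_eq0 // irredp_neq0.
have := F2_even_odd (h * w) => /(congr1 iota).
set p := even_poly _ in e *; set q := odd_poly _ => E.
exists (p%:F / w%:F), (q%:F / w%:F).
rewrite e rmorphD mulrDl [RHS]addrAC; congr (_ + _).
have -> : h%:F / w%:F = (h * w)%:F / w%:F ^+ 2.
  by rewrite rmorphM; field.
rewrite E rmorphD (rmorphM iota 'X) !rmorphXn /=; field.
exact: wF.
Qed.

(** An extra factor [w] makes an odd exponent even. Then the numerator splits into even and odd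
    parts, and [AS_cartier] halves the exponent; the even part keeps the constant term. *)
Lemma AS_irred_pow (w a : {poly 'F_2}) (k : nat) : irreducible_poly w -> w`_0 = 1 ->
  (size a <= k * (size w).-1)%N -> a`_0 = 0 -> AS (a%:F / (w ^+ k)%:F).
Proof.
move=> wi w0; have [w1 _] := wi.
elim/ltn_ind: k a => -[|[|k]] IH a sa a0.
- move: sa; rewrite leqn0 size_poly_eq0 => /eqP ->.
  by rewrite rmorph0 mul0r; exact: AS0.
- by rewrite expr1; apply: AS_irred => //; size_lia.
have wn0 := irredp_neq0 wi.
set j := uphalf k.+2.
have jk : (j.*2 = odd k + k.+2)%N by rewrite /j uphalf_half /=; have := odd_double_half k; lia.
pose a' := a * w ^+ odd k.
have -> : a%:F / (w ^+ k.+2)%:F = a'%:F / (w ^+ j)%:F ^+ 2.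
  rewrite -rmorphXn -exprM muln2 jk exprD /a'.
  have := expf_neq0 k.+2 wn0; have := expf_neq0 (odd k) wn0.
  move: (w ^+ k.+2) (w ^+ odd k) => P Q Q0 P0.
  by rewrite !rmorphM; field; rewrite !iota_eq0 // P0 Q0.
have sa' : (size a' <= (j * (size w).-1).*2)%N.
  rewrite doubleMl jk mulnDl /a'; apply: leq_trans (size_polyMleq _ _) _.
  move: sa; set m := (k.+2 * _)%N.
  by case: (odd k); rewrite /= ?expr1 ?expr0 ?size_poly1 ?mul1n ?mul0n; size_lia.
have a'0 : a'`_0 = 0 by rewrite coef0M a0 mul0r.
rewrite (F2_even_odd a') rmorphD (rmorphM iota 'X) !rmorphXn /= mulrDl -mulrA -!expr_div_n.
apply/AS_cartier; rewrite -(rmorphXn iota j) /=; apply: IH.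
- by rewrite /j ltn_uphalf_double; lia.
- apply: leq_trans (size_even_poly _) _.
  by rewrite leq_uphalf_double.
- by rewrite coef_even_poly.
Qed.

Lemma AS_partial_fractions (a1 a2 b1 b2 : {poly 'F_2}) : coprimep b1 b2 ->
  (size a1 < size b1)%N -> (size a2 < size b2)%N ->
  AS ((a1 * b2 + a2 * b1)%:F / (b1 * b2)%:F) <->
  AS (a1%:F / b1%:F) /\ AS (a2%:F / b2%:F).
Proof.
move=> cb s1 s2; have [b10 b20] := (gt_size_neq0 s1, gt_size_neq0 s2).
have -> : (a1 * b2 + a2 * b1)%:F / (b1 * b2)%:F = a1%:F / b1%:F + a2%:F / b2%:F.
  rewrite rmorphD !rmorphM; field.
  by rewrite !iota_eq0 ?b10 ?b20.
split=> [h|[h1 h2]]; last exact: AS_add.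
suff h1 : AS (a1%:F / b1%:F) by split=> //; exact: AS_addr h1 h.
have [|||u [v [_ _ _ _ ->]]] := AS_split iota_inj iota_frac b10 _ _ _ h.
- by exists 1%N, a1; rewrite expr1.
- by exists a1, b1.
- by exists a2, b2; rewrite coprimep_sym.
by exists u, v.
Qed.

Lemma AS_polynomial_part (p a b : {poly 'F_2}) : (size a < size b)%N ->
  AS (p%:F + a%:F / b%:F) <-> p`_0 = 0 /\ AS (a%:F / b%:F).
Proof.
move=> sab; split=> [h|[p0 h]]; last by apply: AS_add => //; exact: AS_poly.
have p0 : p`_0 = 0.
  by apply: (AS_poly_proper iota_inj iota_frac _ h); exists a, b.
by split=> //; apply: AS_addr h; exact: AS_poly.
Qed.

End LocalCriteria.

(** * Multiplicative functions on polynomials *)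

Definition polys (n : nat) : seq {poly 'F_2} := [seq rVpoly v | v <- enum 'rV['F_2]_n].

Definition deg_polys (m : nat) : seq {poly 'F_2} := [seq p : {poly 'F_2} <- polys m.+1 | size p == m.+1].

Definition places (n : nat) : seq {poly 'F_2} := [seq w <- polys n.+1 | is_place_fin w].

Lemma mem_polys n p : (p \in polys n) = (size p <= n)%N.
Proof.
apply/mapP/idP => [[v _ ->]|pn]; first exact: size_poly.
by exists (poly_rV p); rewrite ?mem_enum // poly_rV_K.
Qed.

Lemma polys_uniq n : uniq (polys n).
Proof. by rewrite map_inj_uniq ?enum_uniq //; exact: can_inj rVpolyK. Qed.

Lemma polys0 : polys 0 = [:: 0].
Proof.
apply: perm_small_eq => //; apply: uniq_perm => //; first exact: polys_uniq.
by move=> p; rewrite mem_polys inE leqn0 size_poly_eq0.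
Qed.

Lemma size_polys n : size (polys n) = (2 ^ n)%N.
Proof. by rewrite size_map -cardE card_mx mul1n card_Fp. Qed.

Lemma mem_deg_polys m p : (p \in deg_polys m) = (size p == m.+1).
Proof. by rewrite mem_filter mem_polys; case: eqVneq => // ->; rewrite leqnn. Qed.

Lemma deg_polys_uniq m : uniq (deg_polys m).
Proof. exact: filter_uniq (polys_uniq _). Qed.

Lemma size_deg_polys m : size (deg_polys m) = (2 ^ m)%N.
Proof.
have := count_predC (fun p : {poly 'F_2} => size p == m.+1) (polys m.+1).
rewrite size_polys -size_filter -/(deg_polys m).
have -> : count (predC (fun p : {poly 'F_2} => size p == m.+1)) (polys m.+1) = (2 ^ m)%N.
  rewrite -size_filter -(size_polys m); apply: perm_size; apply: uniq_perm.
  - exact: filter_uniq (polys_uniq _).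
  - exact: polys_uniq.
  by move=> p; rewrite mem_filter !mem_polys /=; lia.
by rewrite expnS; lia.
Qed.

Lemma placeP (w : {poly 'F_2}) : reflect (irreducible_poly w) (is_place_fin w).
Proof.
apply: (iffP andP) => [[_ /asboolP //]|wi]; split; last exact/asboolP.
exact: F2_monic (irredp_neq0 wi).
Qed.

Lemma mem_places n w : (w \in places n) = is_place_fin w && (size w <= n.+1)%N.
Proof. by rewrite mem_filter mem_polys. Qed.

Lemma places_uniq n : uniq (places n).
Proof. exact: filter_uniq (polys_uniq _). Qed.

Lemma irredp_dvdp (p : {poly 'F_2}) : (1 < size p)%N ->
  exists2 w, irreducible_poly w & w %| p.
Proof.
move: {2}(size p) (leqnn (size p)) => n.
elim: n p => [|n IH] p; first by rewrite leqn0 => /eqP ->.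
move=> pn p1; case: (pselect (irreducible_poly p)) => [|nip]; first by exists p.
have p0 : p != 0 by rewrite -size_poly_gt0; lia.
have [q [q1 [qp nqp]]] : exists q : {poly 'F_2}, size q != 1 /\ (q %| p /\ ~~ (q %= p)).
  apply: contrapT => H; apply: nip; split=> // q q1 qp.
  by apply: contrapT => /negP nqp; apply: H; exists q.
have q0 : q != 0 by apply: contraNneq p0 => h; rewrite h dvd0p in qp.
have sq : (size q < size p)%N.
  by rewrite ltn_neqAle dvdp_leq // andbT; apply: contraNneq nqp => h; rewrite -dvdp_size_eqp // h.
have [||w wi wq] := IH q; [by size_lia| by move: q1; have := size_poly_eq0 q; rewrite (negPf q0); size_lia |].
by exists w => //; exact: dvdp_trans wq qp.
Qed.

Lemma irredp_dvd_irredp (w v : {poly 'F_2}) : irreducible_poly w -> irreducible_poly v ->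
  w %| v -> w = v.
Proof. by move=> [w1 _] [_ h] wv; apply/F2_eqp/h => //; rewrite neq_ltn w1 orbT. Qed.

Lemma irredp_dvdM (w p q : {poly 'F_2}) : irreducible_poly w ->
  (w %| p * q) = (w %| p) || (w %| q).
Proof.
move=> wi; have [wp|nwp] := boolP (w %| p); first by rewrite dvdp_mulr.
by rewrite Gauss_dvdpr // irredp_coprime.
Qed.

Lemma size_expS (w : {poly 'F_2}) k : w != 0 -> size (w ^+ k) = (k * degw w).+1.
Proof.
move=> w0; have /prednK <- : (0 < size (w ^+ k))%N by rewrite size_poly_gt0 expf_neq0.
by rewrite size_exp mulnC.
Qed.

Lemma degw_gt0 w : irreducible_poly w -> (0 < degw w)%N.
Proof. by case=> w1 _; rewrite /degw -ltnS prednK ?(ltnW w1). Qed.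

Lemma mult_dvd (w p : {poly 'F_2}) k : irreducible_poly w -> p != 0 ->
  (w ^+ k %| p) = (k <= mult w p)%N.
Proof.
move=> wi p0; have w0 := irredp_neq0 wi.
apply/idP/idP => [h|h]; last first.
  apply: dvdp_trans (dvdp_exp2l _ h) _; rewrite /mult.
  elim/big_ind: _ => [|x y hx hy|//]; first by rewrite expr0 dvd1p.
  by case: (leqP x y).
have kp : (k < size p)%N.
  have := dvdp_leq p0 h; rewrite size_expS //; apply: leq_trans.
  by rewrite ltnS leq_pmulr // degw_gt0.
exact: (@leq_bigmax_cond _ (fun i : 'I_(size p) => w ^+ i %| p) _ (Ordinal kp)).
Qed.

Lemma mult_eq (w q : {poly 'F_2}) k : irreducible_poly w -> ~~ (w %| q) ->
  mult w (w ^+ k * q) = k.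
Proof.
move=> wi nwq; have w0 := irredp_neq0 wi.
have q0 : q != 0 by apply: contraNneq nwq => ->; exact: dvdp0.
have p0 : w ^+ k * q != 0 by rewrite mulf_neq0 ?expf_neq0.
apply/eqP; rewrite eqn_leq -mult_dvd // dvdp_mulr // andbT leqNgt -mult_dvd //.
by rewrite exprSr dvdp_mul2l // expf_neq0.
Qed.

Lemma mult_decomp (w p : {poly 'F_2}) : irreducible_poly w -> p != 0 ->
  exists2 q, p = w ^+ mult w p * q & ~~ (w %| q).
Proof.
move=> wi p0; have : w ^+ mult w p %| p by rewrite mult_dvd.
move=> /dvdpP [q e]; exists q; first by rewrite mulrC.
apply/negP => /dvdpP [r er].
have : w ^+ (mult w p).+1 %| p by rewrite {2}e er exprS -mulrA dvdp_mulIr.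
by rewrite mult_dvd // ltnn.
Qed.

Definition smooth (s : seq {poly 'F_2}) (b : {poly 'F_2}) : bool :=
  `[< forall w, irreducible_poly w -> w %| b -> w \in s >].

Arguments smooth : simpl never.

Lemma smooth_nil m b : b \in deg_polys m -> smooth [::] b = (b == 1).
Proof.
rewrite mem_deg_polys => /eqP sb; apply/asboolP/eqP => [h|-> w [w1 _]]; last first.
  by rewrite dvdp1 => /eqP w1'; rewrite w1' in w1.
have [s1|s1] := ltnP 1 (size b); first by have [w wi /(h w wi)] := irredp_dvdp s1.
have /size_poly1P [c c0 ->] : size b == 1 by rewrite sb in s1 *; lia.
by rewrite (F2_neq0 c0).
Qed.

Lemma smooth_cons (w b : {poly 'F_2}) s k : irreducible_poly w -> w \notin s ->
  ~~ (w %| b) -> smooth (w :: s) (w ^+ k * b) = smooth s b.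
Proof.
move=> wi ws nwb; apply/asboolP/asboolP => [h v vi vb|h v vi].
  have := h v vi (dvdp_mull _ vb); rewrite inE => /orP [/eqP e|//].
  by rewrite e (negPf nwb) in vb.
rewrite irredp_dvdM // => /orP [|vb]; last by rewrite inE (h v vi vb) orbT.
case: k => [|k]; first by rewrite expr0 dvdp1 => /eqP v1; case: vi; rewrite v1.
move=> vw; have : v %| w.
  elim: k vw => [|k IH]; first by rewrite expr1.
  by rewrite exprS irredp_dvdM // => /orP [|/IH].
by move/(irredp_dvd_irredp vi wi) => ->; rewrite mem_head.
Qed.

Section EulerProduct.
Variables (R : comNzRingType) (f : {poly 'F_2} -> R).
Hypothesis f1 : f 1 = 1.
Hypothesis fM : forall w b k, irreducible_poly w -> ~~ (w %| b) ->
  f (w ^+ k * b) = f (w ^+ k) * f b.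

(** The terms are sorted by the exact multiplicity [k] of [w]; division by [w^k] is a bijection onto
    the [s]-smooth polynomials of the remaining degree. *)
Lemma smooth_sum_cons w s m : irreducible_poly w -> w \notin s ->
  \sum_(b <- deg_polys m | smooth (w :: s) b) f b =
  \sum_(k < m.+1 | (k * degw w <= m)%N)
     f (w ^+ k) * \sum_(b <- deg_polys (m - k * degw w) | smooth s b) f b.
Proof.
move=> wi ws; have w0 := irredp_neq0 wi; have d0 := degw_gt0 wi.
transitivity (\sum_(k < m.+1 | (k * degw w <= m)%N)
   \sum_(b <- deg_polys m | smooth (w :: s) b && (mult w b == k)) f b).
  rewrite (exchange_big_dep (smooth (w :: s))) /=; last by move=> ? ? _ /andP [].
  rewrite big_seq_cond [RHS]big_seq_cond; apply: eq_bigr => b /andP [].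
  rewrite mem_deg_polys => /eqP sb sm.
  have b0 : b != 0 by rewrite -size_poly_gt0 sb.
  have le : (mult w b * degw w <= m)%N.
    have : w ^+ mult w b %| b by rewrite mult_dvd.
    by move/(dvdp_leq b0); rewrite size_expS // sb.
  have lt : (mult w b < m.+1)%N by rewrite ltnS (leq_trans _ le) // leq_pmulr.
  rewrite (big_pred1 (Ordinal lt)) // => k /=.
  by rewrite sm /= eq_sym -val_eqE /=; case: eqVneq => [->|]; rewrite ?le ?andbF.
apply: eq_bigr => k km; rewrite mulr_sumr -big_filter -[RHS]big_filter.
set l := [seq b <- deg_polys (m - _) | _].
have nw b : b \in l -> ~~ (w %| b).
  rewrite mem_filter => /andP [/asboolP h _]; apply/negP => /(h w wi).
  by rewrite (negPf ws).
transitivity (\sum_(b <- [seq w ^+ k * b | b <- l]) f b); last first.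
  rewrite big_map big_seq [RHS]big_seq; apply: eq_bigr => b bl.
  by rewrite fM // nw.
apply: perm_big; apply: uniq_perm.
- exact: filter_uniq (deg_polys_uniq _).
- rewrite map_inj_uniq; first exact: filter_uniq (deg_polys_uniq _).
  by apply: mulfI; rewrite expf_neq0.
move=> b; apply/idP/mapP => [|[c cl ->]].
  rewrite mem_filter mem_deg_polys => /andP [/andP [sm /eqP mk] /eqP sb].
  have b0 : b != 0 by rewrite -size_poly_gt0 sb.
  have [q e nwq] := mult_decomp wi b0; rewrite mk in e.
  have q0 : q != 0 by apply: contraNneq b0 => h; rewrite e h mulr0.
  have sq : smooth s q by rewrite -(smooth_cons k wi ws nwq) -e.
  exists q => //; rewrite mem_filter mem_deg_polys; apply/andP; split; first exact: sq.
  move: sb; rewrite e size_mul ?expf_neq0 // size_expS //.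
  by have := size_poly_gt0 q; rewrite q0; size_lia.
have nwc := nw c cl.
have [scs] : smooth s c /\ c \in deg_polys (m - k * degw w).
  by apply/andP; move: cl; rewrite mem_filter.
rewrite mem_deg_polys => /eqP sc.
have c0 : c != 0 by rewrite -size_poly_gt0 sc.
have sc' : smooth (w :: s) (w ^+ k * c) by rewrite (smooth_cons k wi ws nwc).
rewrite mem_filter; apply/andP; split; first by apply/andP; split; rewrite ?mult_eq.
by rewrite mem_deg_polys size_mul ?expf_neq0 // size_expS // sc; lia.
Qed.

(** Cutting each local series at [k <= n] is harmless: places have positive degree, so larger [k]
    only affect coefficients beyond [n]. *)
Lemma euler_product_smooth n s i : {in s, forall w, irreducible_poly w} -> uniq s ->
  (i <= n)%N ->
  (\prod_(w <- s) \sum_(k < n.+1) f (w ^+ k) *: 'X^(k * degw w))`_i =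
  \sum_(b <- deg_polys i | smooth s b) f b.
Proof.
elim: s i => [|w s IH] i.
  move=> _ _ _; rewrite big_nil coef1.
  rewrite big_seq_cond (eq_bigl (fun b => (b \in deg_polys i) && (b == 1))); last first.
    by move=> b; case h : (b \in _) => //=; rewrite (smooth_nil h).
  have [->|i0] := eqVneq i 0%N.
    rewrite -big_seq_cond -big_filter (_ : [seq b <- _ | _] = [:: 1]) ?big_seq1 //.
    apply: perm_small_eq => //; apply: uniq_perm => //; first exact: filter_uniq (deg_polys_uniq _).
    move=> b; rewrite mem_filter mem_deg_polys inE.
    by case: eqVneq => // ->; rewrite size_poly1.
  rewrite big1 // => b /andP [+ /eqP e]; rewrite mem_deg_polys e size_poly1.
  by case: i i0.
move=> sw /andP [ws us] iN.
have wi : irreducible_poly w by apply: sw; rewrite mem_head.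
have d0 := degw_gt0 wi.
rewrite big_cons mulr_suml coef_sum smooth_sum_cons //.
rewrite [RHS](big_ord_widen_cond n.+1 (fun k => (k * degw w <= i)%N)
  (fun k => f (w ^+ k) * \sum_(b <- deg_polys (i - k * degw w) | smooth s b) f b)) //.
rewrite [RHS]big_mkcond; apply: eq_bigr => k _.
rewrite -scalerAl coefZ coefXnM; case: ltnP => ki /=.
  by rewrite mulr0.
rewrite ltnS (leq_trans _ ki) ?leq_pmulr //= IH //.
- by move=> v vs; apply: sw; rewrite inE vs orbT.
- by lia.
Qed.

Lemma euler_product n i : (i <= n)%N ->
  (\prod_(w <- places n) \sum_(k < n.+1) f (w ^+ k) *: 'X^(k * degw w))`_i =
  \sum_(b <- deg_polys i) f b.
Proof.
move=> iN; rewrite euler_product_smooth //; first last.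
- exact: places_uniq.
- by move=> w; rewrite mem_places => /andP [/placeP].
rewrite big_seq_cond [RHS]big_seq; apply: eq_bigl => b.
case: (boolP (b \in _)) => //=; rewrite mem_deg_polys => /eqP sb.
apply/asboolP => w wi wb; rewrite mem_places; apply/andP; split; first exact/placeP.
have b0 : b != 0 by rewrite -size_poly_gt0 sb.
by apply: leq_trans (dvdp_leq b0 wb) _; rewrite sb.
Qed.

End EulerProduct.

(** * Counting admissible fractions *)

(** At [n = 0] only the zero polynomial remains, and [n.-1 = 0] gives the right value [1];
    [fcount_irred] relies on this at [k = 0]. *)
Lemma F2_count_coef0 n : count (fun p : {poly 'F_2} => p`_0 == 0) (polys n) = (2 ^ n.-1)%N.
Proof.
case: n => [|n]; first by rewrite polys0 /= coef0 eqxx.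
rewrite -size_filter /= -(size_polys n) -[RHS](size_map (fun p => p * 'X)).
apply: perm_size; apply: uniq_perm.
- exact: filter_uniq (polys_uniq _).
- rewrite map_inj_uniq; [exact: polys_uniq | by apply: mulIf; rewrite polyX_eq0].
move=> p; rewrite mem_filter mem_polys; apply/andP/mapP => [[/eqP p0 sp]|[q]].
  have /dvdpP [q e] : 'X %| p.
    by rewrite -['X]subr0 -(polyC0) dvdp_XsubCl; apply/rootP; rewrite horner_coef0.
  exists q => //; rewrite mem_polys; move: sp; rewrite e.
  by have [->|q0] := eqVneq q 0; rewrite ?size_poly0 // size_mulX.
rewrite mem_polys => sq ->; split; first by rewrite coefMX.
by have [->|q0] := eqVneq q 0; rewrite ?mul0r ?size_poly0 // size_mulX.
Qed.

Lemma count_dvd_split (w : {poly 'F_2}) (Q : pred {poly 'F_2}) n : w != 0 ->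
  (forall p, Q (p * w) = Q p) ->
  (count (fun p : {poly 'F_2} => ~~ (w %| p)%R && Q p) (polys (n + degw w)) + count Q (polys n)
   = count Q (polys (n + degw w)))%N.
Proof.
move=> w0 Qw; set l := polys (n + degw w).
have sw : (size w).-1.+1 = size w by rewrite prednK // size_poly_gt0.
have -> : count Q (polys n) = count (fun p : {poly 'F_2} => (w %| p) && Q p) l.
  rewrite -!size_filter -[LHS](size_map (fun p => p * w)); apply: perm_size; apply: uniq_perm.
  - rewrite map_inj_uniq; [exact/filter_uniq/polys_uniq | exact: mulIf].
  - exact/filter_uniq/polys_uniq.
  have szw (q : {poly 'F_2}) : (size (q * w)%R <= n + degw w)%N = (size q <= n)%N.
    have [->|q0] := eqVneq q 0; first by rewrite mul0r size_poly0.
    rewrite size_mul // -sw addnS /=; exact: leq_add2r.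
  move=> p; rewrite mem_filter mem_polys; apply/mapP/andP => [[q]|[/andP [/dvdpP [q ->] Qp]]].
    rewrite mem_filter mem_polys => /andP [Qq sq] ->.
    by rewrite szw dvdp_mull // Qw.
  by rewrite szw => sq; exists q => //; rewrite mem_filter mem_polys sq -Qw Qp.
elim: (l) => //= p s <-.
by case: (w %| p); case: (Q p) => /=; lia.
Qed.

Section Counting.
Variables (L : fieldType) (iota : {rmorphism {poly 'F_2} -> L}).
Hypothesis iota_inj : injective iota.
Hypothesis iota_frac : forall z : L, exists a b : {poly 'F_2}, b != 0 /\ z = iota a / iota b.
Local Notation "p %:F" := (iota p).
Local Notation AS := (@AS L iota).

Definition split_frac (a b : {poly 'F_2}) : bool := `[< AS (a%:F / b%:F) >].

Definition fcount (b : {poly 'F_2}) : nat :=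
  count (fun a => coprimep a b && split_frac a b) (polys (degw b)).

Lemma degw_mul (b c : {poly 'F_2}) : b != 0 -> c != 0 -> degw (b * c) = (degw b + degw c)%N.
Proof.
move=> b0 c0; rewrite /degw size_mul //.
by move: (size_poly_gt0 b) (size_poly_gt0 c); rewrite b0 c0; size_lia.
Qed.

Lemma degw_lt (a b : {poly 'F_2}) : b != 0 -> (size a <= degw b)%N = (size a < size b)%N.
Proof. by rewrite -size_poly_gt0 /degw => /prednK {2}<-. Qed.

(** Chinese remainders as partial fractions: [(a1, a2) -> a1 b2 + a2 b1] is a bijection between
    proper numerators that respects coprimality and, by [AS_partial_fractions], admissibility. *)
Lemma fcount_mul (b1 b2 : {poly 'F_2}) : coprimep b1 b2 -> b1 != 0 -> b2 != 0 ->
  fcount (b1 * b2) = (fcount b1 * fcount b2)%N.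
Proof.
move=> cb b10 b20; rewrite /fcount -!size_filter -(size_allpairs (fun a1 a2 => a1 * b2 + a2 * b1)).
have sz (a b : {poly 'F_2}) : b != 0 ->
    a \in [seq a <- polys (degw b) | coprimep a b && split_frac a b] ->
    [/\ (size a < size b)%N, coprimep a b & AS (a%:F / b%:F)].
  by move=> b0; rewrite mem_filter mem_polys degw_lt // => /andP [/andP [-> /asboolP]].
have szM (a1 a2 : {poly 'F_2}) : (size a1 < size b1)%N -> (size a2 < size b2)%N ->
    (size (a1 * b2 + a2 * b1)%R < size (b1 * b2)%R)%N.
  move=> s1 s2; rewrite size_mul //; apply: leq_ltn_trans (size_polyD _ _) _.
  by rewrite gtn_max; apply/andP; split; apply: leq_ltn_trans (size_polyMleq _ _) _; size_lia.
have inj (a1 a2 c1 c2 : {poly 'F_2}) : (size a1 < size b1)%N -> (size c1 < size b1)%N ->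
    a1 * b2 + a2 * b1 = c1 * b2 + c2 * b1 -> a1 = c1 /\ a2 = c2.
  move=> s1 t1 e.
  have e' : (a1 - c1) * b2 = (c2 - a2) * b1.
    by apply/eqP; rewrite -subr_eq0 !mulrBl -(subrr (c1 * b2 + c2 * b1)) -{1}e; apply/eqP; ring.
  have : b1 %| a1 - c1 by rewrite -(@Gauss_dvdpl _ _ b2) // e' dvdp_mulIr.
  have [/eqP|n0] := eqVneq (a1 - c1) 0; last first.
    move/(dvdp_leq n0); rewrite leqNgt (leq_ltn_trans (size_polyD _ _)) //.
    by rewrite size_polyN gtn_max s1.
  rewrite subr_eq0 => /eqP ac _; split=> //.
  by move: e; rewrite ac => /addrI /(mulIf b10).
apply: perm_size; apply: uniq_perm.
- exact/filter_uniq/polys_uniq.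
- apply: allpairs_uniq; [exact/filter_uniq/polys_uniq|exact/filter_uniq/polys_uniq|].
  move=> [a1 a2] [c1 c2] /allpairsP [[x1 x2] /= [hx1 hx2 [-> ->]]].
  move=> /allpairsP [[y1 y2] /= [hy1 hy2 [-> ->]]].
  have [sx _ _] := sz _ _ b10 hx1; have [sy _ _] := sz _ _ b10 hy1.
  by move=> /(inj _ _ _ _ sx sy) [-> ->].
have b120 : b1 * b2 != 0 by rewrite mulf_neq0.
have cop (a1 a2 : {poly 'F_2}) :
    coprimep (a1 * b2 + a2 * b1) (b1 * b2) = coprimep a1 b1 && coprimep a2 b2.
  rewrite coprimepMr; congr (_ && _); rewrite coprimep_sym.
    rewrite addrC coprimep_addl_mul coprimepMr cb andbT coprimep_sym //.
  rewrite coprimep_addl_mul coprimepMr (coprimep_sym b2 b1) cb andbT coprimep_sym //.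
move=> a; apply/idP/allpairsP => [/(sz _ _ b120) [sa ca aa]|[[a1 a2] /= [h1 h2 ->]]]; last first.
  have [s1 c1 as1] := sz _ _ b10 h1; have [s2 c2 as2] := sz _ _ b20 h2.
  rewrite mem_filter mem_polys degw_lt // szM // cop c1 c2 /= andbT.
  by apply/asboolP/AS_partial_fractions.
have /Bezout_eq1_coprimepP [[u v] /= uv] := cb.
(* Only [a1] is reduced; the bound on [a2] is then forced by the degree of [a]. *)
pose a1 := (a * v) %% b1; pose a2 := a * u + (a * v) %/ b1 * b2.
have ea : a = a1 * b2 + a2 * b1.
  rewrite /a2; transitivity (((a * v) %/ b1 * b1 + a1) * b2 + a * u * b1); last by ring.
  by rewrite -divp_eq -[LHS]mulr1 -uv; ring.
have s1 : (size a1 < size b1)%N by rewrite ltn_modp.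
clearbody a1 a2.
have s2 : (size a2 < size b2)%N.
  have p2 : (0 < size b2)%N by rewrite size_poly_gt0.
  rewrite ltnNge; apply/negP => s2.
  have a20 : a2 != 0 by rewrite -size_poly_gt0 (leq_trans _ s2) // size_poly_gt0.
  have e2 : a2 * b1 = a - a1 * b2 by rewrite {1}ea addrAC subrr add0r.
  have : (size (a2 * b1)%R < size (b1 * b2)%R)%N.
    rewrite e2; apply: leq_ltn_trans (size_polyD _ _) _; rewrite size_polyN gtn_max sa /=.
    by apply: leq_ltn_trans (size_polyMleq _ _) _; rewrite size_mul //; size_lia.
  by rewrite !size_mul //; size_lia.
exists (a1, a2); split=> //=; rewrite mem_filter mem_polys degw_lt ?s1 ?s2 // andbT.
  move: ca aa; rewrite {1 2}ea cop => /andP [-> _] aa /=; apply/asboolP.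
  by have /AS_partial_fractions [] := aa.
move: ca aa; rewrite {1 2}ea cop => /andP [_ ->] aa /=; apply/asboolP.
by have /AS_partial_fractions [] := aa.
Qed.

Lemma fcount1 : fcount 1 = 1%N.
Proof.
rewrite /fcount /degw size_poly1 polys0 /= coprimep1 /=; have -> // : split_frac 0 1.
by apply/asboolP; rewrite rmorph0 mul0r; exact: AS0.
Qed.

Lemma degw_exp (w : {poly 'F_2}) k : w != 0 -> degw (w ^+ k) = (k * degw w)%N.
Proof. by move=> w0; rewrite {1}/degw size_expS. Qed.

Lemma coprimep_irredX (w a : {poly 'F_2}) k : irreducible_poly w ->
  coprimep a (w ^+ k.+1) = ~~ (w %| a).
Proof.
move=> wi; rewrite coprimep_sym coprimep_pexpl //; apply/idP/idP; last exact: irredp_coprime.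
move=> cwa; apply/negP => /(coprimep_dvdl) /(_ cwa); rewrite coprimepp.
by case: wi => w1 _ /eqP h; rewrite h in w1.
Qed.

(** From the numerators vanishing at [0] the multiples of [w] are removed. As [w(0) = 1], their
    quotients by [w] also vanish at [0], so [F2_count_coef0] counts them too. *)
Lemma fcount_irred (w : {poly 'F_2}) k : irreducible_poly w -> w != 'X ->
  (fcount (w ^+ k.+1) + 2 ^ (k * degw w).-1 = 2 ^ (k.+1 * degw w).-1)%N.
Proof.
move=> wi wX; have w0 := irredp_neq0 wi; have w1 := irredp_coef0 wi wX.
have wk1 : (w ^+ k.+1)`_0 = 1 by rewrite -horner_coef0 horner_exp horner_coef0 w1 expr1n.
rewrite -!F2_count_coef0 /fcount degw_exp // mulSn addnC [in RHS]addnC addnC.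
rewrite [in LHS](addnC (degw w)).
rewrite -(@count_dvd_split w (fun p => p`_0 == 0)) //; last by move=> p; rewrite coef0M w1 mulr1.
congr (_ + _)%N; apply: eq_in_count => a; rewrite mem_polys => sa.
rewrite coprimep_irredX //; case: (w %| a) => //=.
have sa' : (size a < size (w ^+ k.+1))%N by rewrite size_expS // mulSn addnC ltnS.
apply/asboolP/eqP => [h|a0].
  exact: (AS_coef0 iota_inj iota_frac wk1 sa').
by apply: AS_irred_pow; rewrite // mulSn addnC.
Qed.

Lemma irredp_X : irreducible_poly ('X : {poly 'F_2}).
Proof. by rewrite -['X]subr0 -polyC0; exact: irredp_XsubC. Qed.

Lemma fcount_X k : (fcount ('X ^+ k.+1) = 2 ^ k)%N.
Proof.
have X0 : ('X : {poly 'F_2}) != 0 by rewrite polyX_eq0.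
have dX : degw 'X = 1%N by rewrite /degw size_polyX.
have := @count_dvd_split 'X predT k X0 (fun _ => erefl).
rewrite !count_predT !size_polys dX addn1 /fcount degw_exp // dX muln1 => e.
have -> : count (fun a => coprimep a ('X ^+ k.+1) && split_frac a ('X ^+ k.+1)) (polys k.+1)
   = count (fun p : {poly 'F_2} => ~~ ('X %| p) && predT p) (polys k.+1); last first.
  apply/eqP; rewrite -(eqn_add2r (2 ^ k)%N); apply/eqP.
  by rewrite [LHS]e expnS mul2n addnn.
apply: eq_in_count => a; rewrite mem_polys => sa.
rewrite coprimep_irredX ?andbT; last exact: irredp_X.
case: ('X %| a) => //=; apply/asboolP; exact: AS_Xpow.
Qed.

End Counting.

Lemma perm_polysS n : perm_eq (polys n.+1) (polys n ++ deg_polys n).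
Proof.
apply: uniq_perm; first exact: polys_uniq.
  rewrite cat_uniq polys_uniq deg_polys_uniq andbT /=; apply/hasPn => p.
  by rewrite mem_deg_polys mem_polys => /eqP ->; rewrite ltnn.
by move=> p; rewrite mem_cat !mem_polys mem_deg_polys leq_eqVlt ltnS orbC.
Qed.

Lemma big_polys (R : Type) (idx : R) (op : Monoid.com_law idx) (g : {poly 'F_2} -> R) n :
  g 0 = idx ->
  \big[op/idx]_(b <- polys n) g b =
  \big[op/idx]_(m < n) \big[op/idx]_(b <- deg_polys m) g b.
Proof.
move=> g0; elim: n => [|n IH]; first by rewrite polys0 big_seq1 big_ord0.
by rewrite (perm_big _ (perm_polysS n)) big_cat IH big_ord_recr.
Qed.

(** Number of admissible polynomial parts of degree [e]. A polynomial vanishing at [0] is never a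
    nonzero constant, so [e = 0] stands for the zero part, where the denominator alone attains the
    height. *)
Definition num_polypart (e : nat) : nat := if e is e'.+1 then (2 ^ e')%N else 1%N.

Definition polyparts (e : nat) : seq {poly 'F_2} :=
  if e is e'.+1 then [seq p : {poly 'F_2} <- deg_polys e | p`_0 == 0] else [:: 0].

Lemma size_polyparts e : size (polyparts e) = num_polypart e.
Proof.
case: e => //= e; rewrite size_filter.
have := F2_count_coef0 e.+2; rewrite (permP (perm_polysS _)) count_cat F2_count_coef0 /=.
by rewrite expnS mul2n -addnn => /addnI.
Qed.

(** * Reduced fractions of given height *)

Section PairCount.
Variables (L : fieldType) (iota : {rmorphism {poly 'F_2} -> L}).
Hypothesis iota_inj : injective iota.
Hypothesis iota_frac : forall z : L, exists a b : {poly 'F_2}, b != 0 /\ z = iota a / iota b.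
Local Notation "p %:F" := (iota p).
Local Notation AS := (@AS L iota).

Definition good_pair (M : nat) (x : {poly 'F_2} * {poly 'F_2}) : bool :=
  [&& x.2 != 0, coprimep x.1 x.2, maxn (size x.1) (size x.2) == M.+1
    & split_frac iota x.1 x.2].

Definition good_pairs (M : nat) : seq ({poly 'F_2} * {poly 'F_2}) :=
  [seq x <- [seq (c, b) | b <- polys M.+1, c <- polys M.+1] | good_pair M x].

Lemma mem_good_pairs M x : (x \in good_pairs M) = good_pair M x.
Proof.
rewrite mem_filter; case: (boolP (good_pair M x)) => //= /and4P [_ _ /eqP h _].
apply/allpairsP; exists (x.2, x.1) => /=; rewrite !mem_polys -h.
by rewrite leq_maxr leq_maxl; case: x {h}.
Qed.

Lemma good_pairs_uniq M : uniq (good_pairs M).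
Proof.
apply: filter_uniq; apply: allpairs_uniq; [exact: polys_uniq|exact: polys_uniq|].
by move=> [b c] [b' c'] _ _ /= [-> ->].
Qed.

(** Euclidean division [c = p b + a] separates the polynomial part from the proper part. Coprimality
    concerns [a] alone, and the degree of [c] fixes that of [p]. *)
Lemma good_pair_count M m b : (m <= M)%N -> b \in deg_polys m ->
  count (fun c => good_pair M (c, b)) (polys M.+1) =
  (fcount iota b * num_polypart (M - m))%N.
Proof.
move=> mM; rewrite mem_deg_polys => /eqP sb.
have b0 : b != 0 by rewrite -size_poly_gt0 sb.
have db : degw b = m by rewrite /degw sb.
rewrite mulnC /fcount -!size_filter -size_polyparts -(size_allpairs (fun p a => p * b + a)).
have szc (p a : {poly 'F_2}) : (size a <= m)%N ->
    size (p * b + a) = if p == 0 then size a else (size p + m)%N.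
  move=> sa; case: eqVneq => [->|p0]; first by rewrite mul0r add0r.
  have e : size (p * b) = (size p + m)%N by rewrite size_mul // sb addnS.
  rewrite size_polyDl e // (leq_ltn_trans sa) //.
  by rewrite -[X in (X < _)%N]add0n ltn_add2r size_poly_gt0.
have mem_pp (p : {poly 'F_2}) e : (p \in polyparts e) =
    (p`_0 == 0) && (if e == 0%N then p == 0 else size p == e.+1).
  case: e => [|e] /=; last by rewrite mem_filter mem_deg_polys.
  by rewrite inE; case: eqVneq => [->|]; rewrite ?andbF ?coef0 ?eqxx.
have decomp (p a : {poly 'F_2}) : (size a <= m)%N ->
    (size (p * b + a)%R <= M.+1)%N && good_pair M (p * b + a, b) =
    (p \in polyparts (M - m)) && (coprimep a b && split_frac iota a b).
  move=> sa; rewrite /good_pair /= b0 /=.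
  rewrite coprimep_sym coprimep_addl_mul coprimep_sym mem_pp.
  have -> : split_frac iota (p * b + a) b = (p`_0 == 0) && split_frac iota a b.
    have -> : split_frac iota (p * b + a) b = `[< AS (p%:F + a%:F / b%:F) >].
      by rewrite /split_frac rmorphD rmorphM mulrDl mulfK // iota_eq0.
    apply/asboolP/andP => [/(AS_polynomial_part iota_inj iota_frac)|[/eqP h1 /asboolP h2]].
      by rewrite sb ltnS => /(_ sa) [-> h]; split=> //; exact/asboolP.
    by apply/(AS_polynomial_part iota_inj iota_frac); rewrite ?sb.
  case: (coprimep a b); rewrite /= ?andbF //.
  case: (split_frac iota a b); rewrite /= ?andbF // !andbT.
  have [p0|p0] := eqVneq p`_0 0; rewrite ?andbF //= !andbT sb szc //.
  have sp1 : p != 0 -> (1 < size p)%N.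
    move=> pn0; rewrite ltnNge; apply/negP => sp; move: pn0.
    by rewrite (size1_polyC sp) p0 polyC0 eqxx.
  case: (eqVneq p 0) sp1 => [->|pn0] sp1.
    by rewrite size_poly0; case: ifP; size_lia.
  by have {}sp1 := sp1 isT; case: ifP => h1; size_lia.
have modE (p a : {poly 'F_2}) : (size a <= m)%N -> (p * b + a) %/ b = p /\ (p * b + a) %% b = a.
  move=> sa; have sab : (size a < size b)%N by rewrite sb.
  by rewrite divpD modpD mulpK // modp_mull (divp_small sab) (modp_small sab) addr0 add0r.
have memF (a : {poly 'F_2}) : (a \in [seq a <- polys (degw b) | coprimep a b && split_frac iota a b])
    = (size a <= m)%N && (coprimep a b && split_frac iota a b).
  by rewrite mem_filter mem_polys db andbC.
apply: perm_size; apply: uniq_perm.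
- exact/filter_uniq/polys_uniq.
- apply: allpairs_uniq; [|exact/filter_uniq/polys_uniq|].
    by case: (M - m)%N => // e; exact/filter_uniq/deg_polys_uniq.
  move=> x y /allpairsP [[p a] /= [_ + ->]] /allpairsP [[p' a'] /= [_ + ->]].
  rewrite !memF => /andP [sa _] /andP [sa' _] /= e.
  by have [] := modE p a sa; rewrite e; have [-> ->] := modE p' a' sa'; move=> -> ->.
move=> c; apply/idP/allpairsP => [|[[p a] /= [hp ha ->]]].
  rewrite mem_filter mem_polys andbC (divp_eq c b).
  have sa : (size (c %% b)%R <= m)%N by rewrite -ltnS -sb ltn_modp.
  rewrite decomp // => /andP [hp ha].
  by exists (c %/ b, c %% b); rewrite /= hp memF sa ha.
move: ha; rewrite memF => /andP [sa ha].
by rewrite mem_filter mem_polys andbC decomp // hp ha.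
Qed.

Lemma size_good_pairs M : size (good_pairs M) =
  (\sum_(m < M.+1) \sum_(b <- deg_polys m) fcount iota b * num_polypart (M - m))%N.
Proof.
rewrite size_filter -sum1_count big_mkcond big_allpairs_dep /=.
transitivity (\sum_(b <- polys M.+1) count (fun c => good_pair M (c, b)) (polys M.+1))%N.
  by apply: eq_bigr => b _; rewrite -big_mkcond /= sum1_count.
rewrite big_polys /=; last first.
  apply: etrans (count_pred0 (polys M.+1)); apply: eq_count => c.
  by rewrite /good_pair /= eqxx.
apply: eq_bigr => m _; rewrite big_seq [RHS]big_seq; apply: eq_bigr => b hb.
by apply: good_pair_count; rewrite // -ltnS.
Qed.

Lemma frac_inj (a b c d : {poly 'F_2}) : b != 0 -> d != 0 -> coprimep a b -> coprimep c d ->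
  a%:F / b%:F = c%:F / d%:F -> (a, b) = (c, d).
Proof.
move=> b0 d0 ab cd /eqP; rewrite eqr_div ?iota_eq0 // -!rmorphM iota_eq // => /eqP e.
have bd : b %| d.
  by rewrite -(@Gauss_dvdpr _ d a) 1?coprimep_sym // e dvdp_mull.
have db : d %| b.
  by rewrite -(@Gauss_dvdpr _ b c) 1?coprimep_sym // -e dvdp_mull.
have ebd : b = d by apply: F2_eqp; rewrite /eqp bd.
by move: e; rewrite ebd => /(mulIf d0) ->.
Qed.

Lemma reduced_frac (z : L) : exists a b : {poly 'F_2}, [/\ b != 0, coprimep a b & z = a%:F / b%:F].
Proof.
have [a [b [b0 ->]]] := iota_frac z.
have g0 : gcdp a b != 0 by rewrite gcdp_eq0 (negPf b0) andbF.
have /dvdpP [a' ea] := dvdp_gcdl a b; have /dvdpP [b' eb] := dvdp_gcdr a b.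
have b'0 : b' != 0 by apply: contraNneq b0 => h; rewrite eb h mul0r.
exists a', b'; split=> //.
  have := coprimep_div_gcd (p := a) (q := b); rewrite b0 orbT => /(_ isT).
  have -> : a %/ gcdp a b = a' by rewrite {1}ea mulpK.
  by have -> : b %/ gcdp a b = b' by rewrite {1}eb mulpK.
rewrite {1}ea {2}eb !rmorphM; field.
by rewrite !iota_eq0 // b'0 g0.
Qed.

End PairCount.

(** * Heights *)

Lemma big_places (R : Type) (idx : R) (op : Monoid.com_law idx) (g : {poly 'F_2} -> R) n :
  \big[op/idx]_(f : {ffun 'I_n.+1 -> 'F_2} | is_place_fin (poly_of f)) g (poly_of f) =
  \big[op/idx]_(w <- places n) g w.
Proof.
rewrite /places big_filter -(big_map (@poly_of n) is_place_fin g); apply: perm_big.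
have coefE (f : {ffun 'I_n.+1 -> 'F_2}) i : f i = (poly_of f)`_i.
  by rewrite coef_poly ltn_ord inord_val.
apply: uniq_perm; [rewrite map_inj_uniq ?index_enum_uniq // | exact: polys_uniq |].
  by move=> f g' e; apply/ffunP => i; rewrite !coefE e.
move=> p; rewrite mem_polys; apply/mapP/idP => [[f _ ->]|sp]; first exact: size_poly.
exists [ffun i : 'I_n.+1 => p`_i]; first by rewrite mem_index_enum.
apply/polyP => i; rewrite coef_poly; case: ltnP => ni.
  by rewrite ffunE inordK.
by rewrite nth_default // (leq_trans sp).
Qed.

Lemma mult0 (w p : {poly 'F_2}) : irreducible_poly w -> ~~ (w %| p) -> mult w p = 0%N.
Proof. by move=> wi nw; rewrite -(mult_eq 0 wi nw) expr0 mul1r. Qed.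

Lemma multM (w p q : {poly 'F_2}) : irreducible_poly w -> p != 0 -> q != 0 ->
  mult w (p * q) = (mult w p + mult w q)%N.
Proof.
move=> wi p0 q0; have [p' ep np] := mult_decomp wi p0; have [q' eq nq] := mult_decomp wi q0.
rewrite {1}ep {1}eq mulrACA -exprD mult_eq // irredp_dvdM //.
by rewrite negb_or np.
Qed.

(** Unique factorization read on degrees: one irreducible factor is split off at a time. *)
Lemma sum_mult (b : {poly 'F_2}) n : b != 0 -> (degw b <= n)%N ->
  (\sum_(w <- places n) degw w * mult w b)%N = degw b.
Proof.
move: {2}(size b) (leqnn (size b)) => k.
elim: k b => [|k IH] b; first by rewrite leqn0 size_poly_eq0 => ->.
move=> sk b0 bn; have [s1|s1] := ltnP 1 (size b); last first.
  have -> : degw b = 0%N by rewrite /degw; size_lia.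
  rewrite big_seq big1 // => w; rewrite mem_places => /andP [/placeP wi _].
  rewrite mult0 ?muln0 //; apply/negP => /(dvdp_leq b0).
  by case: wi => w1 _; size_lia.
have [w wi /dvdpP [q e]] := irredp_dvdp s1.
have w0 := irredp_neq0 wi.
have q0 : q != 0 by apply: contraNneq b0 => h; rewrite e h mul0r.
have dE : degw b = (degw q + degw w)%N by rewrite e degw_mul.
have d0 := degw_gt0 wi.
have sq : (size q <= k)%N.
  have : (degw q < degw b)%N by rewrite dE; lia.
  rewrite /degw; have : (0 < size q)%N by rewrite size_poly_gt0.
  by move: sk; size_lia.
have wn : w \in places n.
  rewrite mem_places; apply/andP; split; first exact/placeP.
  by rewrite -[size w]prednK ?size_poly_gt0 // ltnS -/(degw w); lia.
transitivity (\sum_(v <- places n) degw v * mult v q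
   + \sum_(v <- places n) degw v * (v == w))%N; last first.
  rewrite IH //; last by lia.
  rewrite dE; congr (_ + _)%N; rewrite (bigD1_seq w) ?places_uniq //= eqxx muln1.
  by rewrite big1 ?addn0 // => v /negPf ->; rewrite muln0.
rewrite -big_split /= big_seq [RHS]big_seq; apply: eq_bigr => v.
rewrite mem_places => /andP [/placeP vi _]; rewrite -mulnDr e multM //.
congr (_ * (_ + _))%N; case: eqVneq => [->|vw].
  by rewrite -[X in mult _ X]mulr1 -{2}[w]expr1 mult_eq // dvdp1; case: wi; lia.
rewrite mult0 //; apply/negP => /(irredp_dvd_irredp vi wi) h.
by rewrite h eqxx in vw.
Qed.

Lemma frac_cross (L : fieldType) (iota : {rmorphism {poly 'F_2} -> L}) (a b c d : {poly 'F_2}) :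
  injective iota -> b != 0 -> d != 0 -> iota a / iota b = iota c / iota d -> a * d = c * b.
Proof.
move=> inj b0 d0 /eqP; rewrite eqr_div ?iota_eq0 // -!rmorphM iota_eq // => /eqP; exact.
Qed.

Lemma frac_eq0 (L : fieldType) (iota : {rmorphism {poly 'F_2} -> L}) (c d : {poly 'F_2}) :
  injective iota -> c != 0 -> d != 0 -> iota c / iota d != 0.
Proof. by move=> inj c0 d0; rewrite mulf_neq0 ?invr_eq0 ?iota_eq0. Qed.

Local Notation iotaK := (@FracField.tofrac {poly 'F_2}).

Lemma iotaK_inj : injective iotaK.
Proof. by move=> p q /eqP; rewrite tofrac_eq => /eqP. Qed.

Lemma iotaK_frac (z : K) : exists a b : {poly 'F_2}, b != 0 /\ z = iotaK a / iotaK b.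
Proof. exists (numK z), (denK z); split; [exact: denK_neq0|exact: K_numden]. Qed.

Section Height.
Variables (R : realType) (c b : {poly 'F_2}).
Hypotheses (c0 : c != 0) (b0 : b != 0) (cb : coprimep c b).
Let y : K := iotaK c / iotaK b.

Let y0 : y != 0.
Proof. exact: (frac_eq0 iotaK_inj c0 b0). Qed.

(** [numK] and [denK] come from a chosen representative that is not known to be reduced; valuations
    and degrees are read off from this cross relation. *)
Let yE : numK y * b = c * denK y.
Proof. exact: (frac_cross iotaK_inj (denK_neq0 y) b0 (esym (K_numden y))). Qed.

Let num0 : numK y != 0.
Proof.
have h : c * denK y != 0 by rewrite mulf_neq0 // denK_neq0.
by move: h; rewrite -yE mulf_eq0 negb_or => /andP [].
Qed.

Let absv_finE (w : {poly 'F_2}) : irreducible_poly w ->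
  Num.max 1 (absv_fin R w y) = 2 ^+ (degw w * mult w b).
Proof.
move=> wi; rewrite /absv_fin (negPf y0) /val_fin.
have /(congr1 (mult w)) := yE; rewrite !multM //; last exact: denK_neq0.
move: (mult w (numK y)) (mult w (denK y)) => n d nd.
have [wb|nwb] := boolP (w %| b).
  have wc : mult w c = 0%N.
    apply: mult0 => //; apply/negP => wc; have : w %| gcdp c b by rewrite dvdp_gcd wc.
    move: cb; rewrite coprimep_def => /eqP g1 /dvdp_leq; rewrite -size_poly_eq0 g1 => /(_ isT).
    by case: wi => w1 _; size_lia.
  have -> : - ((degw w)%:Z * (n%:Z - d%:Z)) = (degw w * mult w b)%N%:Z by rewrite PoszM; nia.
  by rewrite -exprnP max_r // exprn_ege1 // ler1n.
have wb : mult w b = 0%N by exact: mult0.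
have -> : - ((degw w)%:Z * (n%:Z - d%:Z)) = - (degw w * mult w c)%N%:Z by rewrite PoszM; nia.
by rewrite wb muln0 expr0 -exprnN max_l // -exprVn exprn_ile1 // ?invr_ge0 // invf_le1 ?ler1n.
Qed.

Let absv_infE : Num.max 1 (absv_inf R y) * 2 ^+ degw b = 2 ^+ (maxn (size c) (size b)).-1.
Proof.
rewrite /absv_inf (negPf y0) /val_inf.
have /(congr1 (fun p : {poly 'F_2} => size p)) := yE; rewrite !size_mul //; last exact: denK_neq0.
move: num0 (denK_neq0 y) (c0) (b0); rewrite -!size_poly_gt0 /degw.
move: (numK y) (denK y) => n d; move: (size n) (size d) (size c) (size b) => sn sd sc sb.
move=> h1 h2 h3 h4 e.
have [h|h] := leqP sc sb.
  have -> : - (sd%:Z - sn%:Z) = - (sb - sc)%N%:Z by lia.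
  rewrite -exprnN max_l ?mul1r // -exprVn exprn_ile1 // ?invr_ge0 // invf_le1 ?ler1n //.
have -> : - (sd%:Z - sn%:Z) = (sc - sb)%N%:Z by lia.
rewrite -exprnP max_r; last by rewrite exprn_ege1 // ler1n.
by rewrite -exprD; congr (_ ^+ _); lia.
Qed.

Lemma height_frac : height R y = 2 ^+ (maxn (size c) (size b)).-1.
Proof.
apply: lim_near_cst; first exact: Rhausdorff.
exists (degw b) => // n /= bn.
rewrite /Hpart (big_places _ (fun w => Num.max 1 (absv_fin R w y))).
rewrite -absv_infE; congr (_ * _).
rewrite big_seq (eq_bigr (fun w => 2 ^+ (degw w * mult w b))) => [|w]; last first.
  by rewrite mem_places => /andP [/placeP wi _]; exact: absv_finE.
by rewrite -big_seq -expr_sum sum_mult.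
Qed.

End Height.

Lemma height0 (R : realType) : height R 0 = 1.
Proof.
apply: lim_near_cst; first exact: Rhausdorff.
exists 0%N => // n _; rewrite /Hpart /absv_inf /absv_fin eqxx max_l // mul1r.
by rewrite big1 // => i _; rewrite max_l.
Qed.

Definition pair_frac (x : {poly 'F_2} * {poly 'F_2}) : K := iotaK x.1 / iotaK x.2.

Lemma conic_split (c b : {poly 'F_2}) :
  conic_has_point (iotaK c / iotaK b) <-> split_frac iotaK c b.
Proof.
have h := conic_AS iotaK_inj iotaK_frac (iotaK c / iotaK b).
split=> [/h ?|/asboolP/h //]; exact/asboolP.
Qed.

Lemma pow2_inj (R : realType) : injective (fun n : nat => (2 : R) ^+ n).
Proof. by move=> m n /eqP; rewrite -!natrX eqr_nat eqn_exp2l // => /eqP. Qed.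

Lemma good_set (R : realType) (M : nat) : (0 < M)%N ->
  [set y : K | height R y = 2 ^+ M /\ conic_has_point y]%classic =
  [set` [seq pair_frac x | x <- good_pairs iotaK M]]%classic.
Proof.
move=> M0; apply/seteqP; split=> y /=.
  have [c [b [b0 cb ->]]] := reduced_frac iotaK_inj iotaK_frac y.
  (* [y = 0] has height [1], excluded by [0 < M]. *)
  have [c0|c0] := eqVneq c 0.
      rewrite c0 rmorph0 mul0r height0 => -[+ _]; rewrite -(expr0 (2 : R)) => /pow2_inj h.
    by rewrite -h in M0.
  rewrite (height_frac R c0 b0 cb) => -[/pow2_inj h /conic_split cs].
  apply/mapP; exists (c, b) => //; rewrite mem_good_pairs /good_pair /= b0 cb cs andbT.
  have m0 : (0 < maxn (size c) (size b))%N by rewrite leq_max !size_poly_gt0 c0.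
  by rewrite -h (prednK m0) eqxx.
move=> /mapP [[c b] + ->]; rewrite mem_good_pairs => /and4P [/= b0 cb /eqP h cs].
have c0 : c != 0.
  apply: contraTneq cb => c0; rewrite c0 coprime0p -size_poly_eq1.
  by move: h; rewrite c0 size_poly0 max0n => ->; rewrite eqSS -lt0n.
split; first by rewrite /pair_frac /= (height_frac R c0 b0 cb) h.
exact/conic_split.
Qed.

Lemma NcountE (R : realType) (M : nat) : (0 < M)%N ->
  Ncount R M = (size (good_pairs iotaK M))%:R.
Proof.
move=> M0; rewrite /Ncount (good_set R M0) -fsbig_seq; last first.
  rewrite map_inj_in_uniq; first exact: good_pairs_uniq.
  move=> [c b] [c' b']; rewrite !mem_good_pairs.
  move=> /and4P [/= b0 cb _ _] /and4P [/= b'0 c'b' _ _].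
  exact: (frac_inj iotaK_inj b0 b'0 cb c'b').
by rewrite big_map big_const_seq count_predT iter_addr addr0.
Qed.

(** * Generating functions *)

Section Truncated.
Variable F : fieldType.
Implicit Types p q r : {poly F}.

(* Congruence of power series modulo [X^n]. *)
Definition eqX (n : nat) p q : bool := 'X^n %| p - q.

Lemma eqX_refl n p : eqX n p p.
Proof. by rewrite /eqX subrr dvdp0. Qed.

Lemma eqX_sym n p q : eqX n p q -> eqX n q p.
Proof. by rewrite /eqX -[q - p]opprB dvdpNr. Qed.

Lemma eqX_trans n q p r : eqX n p q -> eqX n q r -> eqX n p r.
Proof.
rewrite /eqX => h1 h2; have -> : p - r = (p - q) + (q - r) by rewrite addrA subrK.
exact: dvdp_add.
Qed.

Lemma eqX_mul n p p' q q' : eqX n p p' -> eqX n q q' -> eqX n (p * q) (p' * q').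
Proof.
rewrite /eqX => h1 h2; have -> : p * q - p' * q' = (p - p') * q + p' * (q - q') by ring.
by apply: dvdp_add; [exact: dvdp_mulr|exact: dvdp_mull].
Qed.

Lemma eqX_prod n (I : eqType) (s : seq I) (f g : I -> {poly F}) :
  (forall i, i \in s -> eqX n (f i) (g i)) ->
  eqX n (\prod_(i <- s) f i) (\prod_(i <- s) g i).
Proof.
move=> h; rewrite big_seq [X in eqX _ _ X]big_seq.
elim/big_ind2: _ => [||i si]; [exact: eqX_refl|by move=> *; exact: eqX_mul|exact: h].
Qed.

Lemma eqX_coef n p q : reflect (forall i, (i < n)%N -> p`_i = q`_i) (eqX n p q).
Proof.
apply: (iffP idP) => [/dvdpP [r e] i ni|h].
  by apply/eqP; rewrite -subr_eq0 -coefB e coefMXn ni.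
rewrite /eqX -(poly_take_drop n (p - q)) (_ : take_poly n (p - q) = 0) ?add0r ?dvdp_mulIr //.
apply/polyP => i; rewrite coef_take_poly coef0 coefB; case: ltnP => // /h ->.
exact: subrr.
Qed.

(** A nonzero constant term makes [r] invertible as a power series. *)
Lemma eqX_cancel n r p q : r`_0 != 0 -> eqX n (p * r) (q * r) -> eqX n p q.
Proof.
move=> r0; rewrite /eqX -mulrBl Gauss_dvdpl // coprimep_expl // coprimep_sym coprimepX.
by rewrite /root horner_coef0.
Qed.

Lemma eqX_mulX n p q : 'X^n %| q -> eqX n (p + q) p.
Proof. by rewrite /eqX addrAC subrr add0r. Qed.

Lemma eqX_leq n m p q : (m <= n)%N -> eqX n p q -> eqX m p q.
Proof. by move=> mn; apply: dvdp_trans; exact: dvdp_exp2l. Qed.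

Lemma dvdX_exp n d (c : F) : (0 < d)%N -> 'X^n %| (c%:P * 'X^d) ^+ n.
Proof.
move=> d0; rewrite exprMn; apply: dvdp_mull; rewrite -exprM; apply: dvdp_exp2l.
exact: leq_pmull.
Qed.

End Truncated.

Section GeneratingFunctions.
Variable R : realType.
Local Notation Xw w := ('X^(degw w) : {poly R}).

(** The zeta function of the affine line: there are [2^m] polynomials of degree [m], so the Euler
    product of [c^(deg b) X^(deg b)] sums to [1 / (1 - 2cX)], and both sides invert it. It is used
    at [c = 1/2] and [c = 1/4]. *)
Lemma zeta_inv (c : R) n :
  eqX n.+1 (\prod_(w <- places n) (1 - (c ^+ degw w)%:P * Xw w)) (1 - (2 * c)%:P * 'X).
Proof.
pose f b := c ^+ degw b.
have f1 : f 1 = 1 by rewrite /f /degw size_poly1.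
have fM w b k : irreducible_poly w -> ~~ (w %| b) -> f (w ^+ k * b) = f (w ^+ k) * f b.
  move=> wi nw; have b0 : b != 0 by apply: contraNneq nw => ->; exact: dvdp0.
  by rewrite /f degw_mul ?exprD // expf_neq0 // irredp_neq0.
pose Z := \prod_(w <- places n) \sum_(k < n.+1) f (w ^+ k) *: ('X^(k * degw w) : {poly R}).
have Z1 : eqX n.+1 (\prod_(w <- places n) (1 - (c ^+ degw w)%:P * Xw w) * Z) 1.
  rewrite /Z -big_split /=.
  apply: (@eqX_trans _ _ (\prod_(w <- places n) 1)); last by rewrite big1 // eqX_refl.
  apply: eqX_prod => w; rewrite mem_places => /andP [/placeP wi _].
  have -> : \sum_(k < n.+1) f (w ^+ k) *: ('X^(k * degw w) : {poly R})
          = \sum_(k < n.+1) ((c ^+ degw w)%:P * Xw w) ^+ k.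
    apply: eq_bigr => k _; rewrite /f degw_exp ?irredp_neq0 // -mul_polyC exprMn -!exprM.
    by rewrite -rmorphXn /= -exprM ![(k * _)%N]mulnC.
  have := subrX1 ((c ^+ degw w)%:P * Xw w) n.+1; rewrite -[_ - 1 as X in _ = X * _]opprB mulNr.
  move=> /eqP; rewrite eq_sym eqr_oppLR opprB => /eqP ->.
  by apply: eqX_mulX; rewrite dvdpNr; apply: dvdX_exp; exact: degw_gt0.
have Z2 : eqX n.+1 ((1 - (2 * c)%:P * 'X) * Z) 1.
  apply: (@eqX_trans _ _ ((1 - (2 * c)%:P * 'X) * \sum_(k < n.+1) ((2 * c)%:P * 'X) ^+ k)).
    apply: eqX_mul; first exact: eqX_refl.
    apply/eqX_coef => i iN; rewrite euler_product // coef_sum.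
    transitivity ((2 * c) ^+ i); last first.
      rewrite (bigD1 (Ordinal iN)) //= big1 => [|k ki].
        by rewrite addr0 [in RHS]exprMn -polyC_exp coefCM coefXn eqxx mulr1.
      rewrite exprMn -polyC_exp coefCM coefXn; case: eqVneq => [e|_]; rewrite ?mulr0 //.
      by move: ki; rewrite -val_eqE /= e eqxx.
    rewrite big_seq (eq_bigr (fun=> c ^+ i)) => [|b]; last first.
      by rewrite mem_deg_polys /f /degw => /eqP ->.
    by rewrite -big_seq big_const_seq count_predT size_deg_polys iter_addr addr0 -[LHS]mulr_natl natrX exprMn.
  have := subrX1 ((2 * c)%:P * 'X : {poly R}) n.+1.
  rewrite -[_ - 1 as X in _ = X * _]opprB mulNr.
  move=> /eqP; rewrite eq_sym eqr_oppLR opprB => /eqP ->.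
  by apply: eqX_mulX; rewrite dvdpNr -['X]expr1; exact: dvdX_exp.
apply: (@eqX_cancel _ _ Z); last exact: eqX_trans Z1 (eqX_sym Z2).
have /eqX_coef /(_ 0%N isT) := Z1; rewrite coef0M coef1 /= => e.
by apply: contra_eq_neq e => ->; rewrite mulr0 eq_sym oner_eq0.
Qed.

End GeneratingFunctions.

(** * The counting series as an Euler product *)

Section MainIdentity.
Variable R : realType.
Variables (L : fieldType) (iota : {rmorphism {poly 'F_2} -> L}).
Hypothesis iota_inj : injective iota.
Hypothesis iota_frac : forall z : L, exists a b : {poly 'F_2}, b != 0 /\ z = iota a / iota b.
Local Notation Xw w := ('X^(degw w) : {poly R}).
Local Notation fc := (fcount iota).

(** The weight [4^-deg] puts the singularity of the counting series at [1]. *)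
Definition fnorm (b : {poly 'F_2}) : R := (fc b)%:R / 4 ^+ degw b.

Lemma fnorm1 : fnorm 1 = 1.
Proof. by rewrite /fnorm fcount1 // /degw size_poly1 expr0 divr1. Qed.

Lemma fnormM w b k : irreducible_poly w -> ~~ (w %| b) ->
  fnorm (w ^+ k * b) = fnorm (w ^+ k) * fnorm b.
Proof.
move=> wi nw; have b0 : b != 0 by apply: contraNneq nw => ->; exact: dvdp0.
have wk0 : w ^+ k != 0 by rewrite expf_neq0 // irredp_neq0.
rewrite /fnorm fcount_mul //; last by rewrite coprimep_expl // irredp_coprime.
by rewrite natrM degw_mul // exprD invfM mulrACA.
Qed.

Lemma geometric_increments (v : nat -> R) (z : {poly R}) n :
  v 0%N = 1 ->
  1 + \sum_(k < n) (v k.+1 - v k)%:P * z ^+ k.+1 =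
  (1 - z) * \sum_(k < n.+1) (v k)%:P * z ^+ k + (v n)%:P * z ^+ n.+1.
Proof.
move=> v0; elim: n => [|n IH].
  by rewrite big_ord0 big_ord1 v0 polyC1 !mul1r mulr1 subrK addr0.
rewrite big_ord_recr /= addrA IH [in RHS]big_ord_recr /= polyCB.
rewrite [z ^+ n.+2]exprS; ring.
Qed.

Lemma geometric_from_one (v : nat -> R) (z : {poly R}) (a c : R) n :
  v 0%N = 1 -> v 1%N = a - c -> (forall k, v k.+2 = a * v k.+1) ->
  (\sum_(k < n.+1) (v k)%:P * z ^+ k) * (1 - a%:P * z) =
  1 - c%:P * z - (v n.+1)%:P * z ^+ n.+1.
Proof.
move=> v0 v1 vS; elim: n => [|n IH].
  by rewrite big_ord1 v0 v1 polyC1 polyCB expr0 expr1; ring.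
rewrite big_ord_recr /= mulrDl IH vS polyCM [z ^+ n.+2]exprS; ring.
Qed.

Definition local_series n w : {poly R} := \sum_(k < n.+1) fnorm (w ^+ k) *: 'X^(k * degw w).

(* At [w = X] the condition [a(0) = 0] is absent, which multiplies the local factor by [(1 - X/4)^-1]. *)
Definition t_correction (w : {poly 'F_2}) : {poly R} :=
  if w == 'X then 1 - (4^-1)%:P * 'X else 1.

(** In both uses [v k] counts the admissible numerators over [w^k] regardless of coprimality, so
    [fcount] is its increment, and summation by parts produces the factor [1 - z]. The shortfall [c]
    of [v 1] from the ratio [2^d] is [0] at [t] and [2^(d-1)] elsewhere. *)
Lemma local_factor n w (v : nat -> R) (c : R) : irreducible_poly w ->
  v 0%N = 1 -> v 1%N = 2 ^+ degw w - c -> (forall k, v k.+2 = 2 ^+ degw w * v k.+1) ->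
  (forall k, (fc (w ^+ k.+1))%:R = v k.+1 - v k :> R) ->
  eqX n.+1 (local_series n w * (1 - (2^-1 ^+ degw w)%:P * Xw w))
    ((1 - (4^-1 ^+ degw w)%:P * Xw w) * (1 - (c * 4^-1 ^+ degw w)%:P * Xw w)).
Proof.
move=> wi v0 v1 vS vf; have w0 := irredp_neq0 wi; have d0 := degw_gt0 wi.
set a := 2 ^+ degw w in v1 vS; set z := (4^-1 ^+ degw w)%:P * Xw w.
have dz m : 'X^m %| z ^+ m by exact: dvdX_exp.
have -> : local_series n w = 1 + \sum_(k < n) (v k.+1 - v k)%:P * z ^+ k.+1.
  rewrite /local_series big_ord_recl expr0 mul0n fnorm1 expr0 scale1r; congr (_ + _).
  apply: eq_bigr => k _; rewrite lift0 /fnorm vf degw_exp // -mul_polyC.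
  rewrite exprMn -polyC_exp -!exprM mulrA -polyCM ![(k.+1 * _)%N]mulnC.
  by rewrite -exprVn.
have -> : (2^-1 ^+ degw w)%:P * Xw w = a%:P * z.
  by rewrite /z mulrA -polyCM /a -exprMn; congr ((_ ^+ _)%:P * _); field.
have -> : (c * 4^-1 ^+ degw w)%:P * Xw w = c%:P * z by rewrite /z polyCM mulrA.
have := @geometric_from_one v z a c n v0 v1 vS; rewrite geometric_increments //.
set S := \sum_(k < n.+1) _ => e.
rewrite mulrDl -[(1 - z) * S * _]mulrA e mulrBr -addrA; apply: eqX_mulX.
rewrite addrC; apply: dvdp_sub; first by rewrite dvdp_mulr // dvdp_mull.
by rewrite dvdp_mull // dvdp_mull.
Qed.

Lemma local_series_eq n w : irreducible_poly w ->
  eqX n.+1 (local_series n w * t_correction w * (1 - (2^-1 ^+ degw w)%:P * Xw w))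
    ((1 - (4^-1 ^+ degw w)%:P * Xw w) * (1 - (2^-1 * 2^-1 ^+ degw w)%:P * Xw w)).
Proof.
move=> wi; rewrite /t_correction; case: eqVneq => [wX|wX].
  have dX : degw w = 1%N by rewrite wX /degw size_polyX.
  have h := @local_factor n w (fun k => 2 ^+ k) 0 wi.
  rewrite mulrAC dX !expr1 (_ : 2^-1 * 2^-1 = 4^-1 :> R); last by field.
  apply: eqX_mul; last exact: eqX_refl.
  move: h; rewrite dX !expr1 expr0 subr0 mul0r polyC0 mul0r subr0 mulr1; apply => //.
  by move=> k; rewrite wX fcount_X // natrX exprS; ring.
rewrite mulr1.
pose v k : R := if k is 0%N then 1 else 2^-1 * 2 ^+ (k * degw w).
have d0 := degw_gt0 wi.
have vE k : v k = (2 ^ (k * degw w).-1)%:R.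
  case: k => //= k; rewrite natrX; have : (0 < k.+1 * degw w)%N by rewrite muln_gt0.
  by case: (k.+1 * degw w)%N => // m _; rewrite exprS mulKf // pnatr_eq0.
have -> : 2^-1 * 2^-1 ^+ degw w = (2^-1 * 2 ^+ degw w) * 4^-1 ^+ degw w :> R.
  by rewrite -mulrA -exprMn; congr (_ * _ ^+ _); field.
apply: (@local_factor n w v) => //.
- by rewrite /v mul1n; field.
- by move=> k; rewrite /v mulrCA -exprD -mulSn.
by move=> k; rewrite !vE -(fcount_irred iota_inj iota_frac k wi wX) natrD addrK.
Qed.

Definition hnorm (M : nat) : R := (size (good_pairs iota M))%:R / 4 ^+ M.

Definition Fnorm (m : nat) : R := \sum_(b <- deg_polys m) fnorm b.

Lemma hnorm_conv M : hnorm M =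
  \sum_(m < M.+1) Fnorm m * ((num_polypart (M - m))%:R / 4 ^+ (M - m)).
Proof.
rewrite /hnorm size_good_pairs // natr_sum mulr_suml; apply: eq_bigr => m _.
rewrite natr_sum !mulr_suml big_seq [RHS]big_seq; apply: eq_bigr => b.
rewrite mem_deg_polys => /eqP sb; rewrite natrM /fnorm /degw sb /=.
have mM : (m <= M)%N by rewrite -ltnS.
by rewrite mulrACA -invfM -exprD subnKC.
Qed.

Lemma generating_function n : (0 < n)%N ->
  eqX n.+1 (\poly_(i < n.+1) hnorm i * (1 - 'X))
    (\prod_(w <- places n) (1 - (2^-1 * 2^-1 ^+ degw w)%:P * Xw w)).
Proof.
move=> n0.
set Pi := \prod_(w <- places n) _.
pose G : {poly R} := \prod_(w <- places n) local_series n w.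
pose kap e : R := (num_polypart e)%:R / 4 ^+ e.
pose kp : {poly R} := \poly_(e < n.+1) kap e.
have GE i : (i < n.+1)%N -> G`_i = Fnorm i.
  by move=> iN; rewrite euler_product //; [exact: fnorm1 | exact: fnormM].
have hG : eqX n.+1 (\poly_(i < n.+1) hnorm i) (G * kp).
  apply/eqX_coef => i iN; rewrite coef_poly iN hnorm_conv coefM; apply: eq_bigr => j _.
  rewrite GE ?(leq_trans (ltn_ord j)) // coef_poly ifT //.
  by rewrite (leq_ltn_trans _ iN) // leq_subr.
(* The polynomial parts have series [(1 - X/4) / (1 - X/2)]. Its numerator supplies the correction
   factor at [t], and its denominator cancels the Euler product [zeta_inv] at [1/4]. *)
have kpE : eqX n.+1 (kp * (1 - (2^-1)%:P * 'X)) (1 - (4^-1)%:P * 'X).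
  have kS e : kap e.+1 = 2^-1 ^+ e.+2.
    have e4 : 4 ^+ e = 2 ^+ e * 2 ^+ e :> R by rewrite -exprMn; congr (_ ^+ _); ring.
    by rewrite /kap /= natrX !exprS exprVn e4; field; rewrite expf_neq0 ?pnatr_eq0.
  have -> : kp = \sum_(e < n.+1) (kap e)%:P * 'X ^+ e.
    by rewrite /kp poly_def; apply: eq_bigr => e _; rewrite mul_polyC.
  rewrite (@geometric_from_one kap 'X 2^-1 4^-1 n).
  - by apply: eqX_mulX; rewrite dvdpNr dvdp_mulIr.
  - by rewrite /kap /= expr0 divr1.
  - by rewrite kS; field.
  - by move=> k; rewrite !kS -exprS.
have GP : eqX n.+1 (G * (1 - (4^-1)%:P * 'X) * (1 - 'X)) ((1 - (2^-1)%:P * 'X) * Pi).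
  have -> : 1 - (4^-1)%:P * 'X = \prod_(w <- places n) t_correction w.
    rewrite (bigD1_seq 'X) ?places_uniq //=; last first.
      rewrite mem_places size_polyX ltnS n0 andbT; apply/placeP; exact: irredp_X.
    rewrite {1}/t_correction eqxx big1 ?mulr1 // => w /negPf wX.
    by rewrite /t_correction wX.
  apply: (@eqX_trans _ _ (G * \prod_(w <- places n) t_correction w *
     \prod_(w <- places n) (1 - (2^-1 ^+ degw w)%:P * Xw w))).
    apply: eqX_mul; first exact: eqX_refl.
    apply: eqX_sym; have := zeta_inv (2^-1 : R) n.
    by rewrite mulfV ?pnatr_eq0 // polyC1 mul1r.
  rewrite /G -!big_split /=.
  apply: (@eqX_trans _ _ (\prod_(w <- places n) (1 - (4^-1 ^+ degw w)%:P * Xw w) * Pi)).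
    rewrite -big_split /=; apply: eqX_prod => w; rewrite mem_places => /andP [/placeP wi _].
    exact: local_series_eq.
  apply: eqX_mul; last exact: eqX_refl.
  have := zeta_inv (4^-1 : R) n; by rewrite (_ : 2 * 4^-1 = 2^-1) //; field.
apply: (@eqX_cancel _ _ (1 - (2^-1)%:P * 'X)).
  by rewrite coefB coef1 coefCM coefX mulr0 subr0 oner_eq0.
rewrite mulrAC [Pi * _]mulrC; apply: eqX_trans GP.
apply: eqX_mul; last exact: eqX_refl.
apply: (@eqX_trans _ _ (G * kp * (1 - (2^-1)%:P * 'X))).
  by apply: eqX_mul; [exact: hG|exact: eqX_refl].
by rewrite -mulrA; apply: eqX_mul; [exact: eqX_refl|exact: kpE].
Qed.

End MainIdentity.

(** * Square root singularity *)

Section SquareRootSeries.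
Variable R : realType.

(* Coefficients [binom(2k, k) / 4^k] of [(1 - X)^(-1/2)]. *)
Fixpoint invsqrt_coef (k : nat) : R :=
  if k is k'.+1 then invsqrt_coef k' * (2 * k' + 1)%:R / (2 * k' + 2)%:R else 1.
Local Notation a := invsqrt_coef.

(* The power series with these coefficients satisfies [2 (1 - X) A' = A]. *)
Lemma invsqrt_coefS k : (k.+1)%:R * a k.+1 = (k%:R + 2^-1) * a k.
Proof.
have k0 : 0 <= k%:R :> R by exact: ler0n.
have k2 : 2 * k%:R + 2 != 0 :> R by apply: lt0r_neq0; lra.
by rewrite /= natrD natrM natrD natrM -[k.+1]addn1 natrD; field.
Qed.

Lemma invsqrt_coef_gt0 k : 0 < a k.
Proof.
elim: k => [|k IH] /=; first exact: ltr01.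
by rewrite divr_gt0 ?mulr_gt0 ?ltr0n ?addn1 ?addn2.
Qed.

(** Let [S_m] be the sum. Weighting its terms by [i] and symmetrizing under [i <-> m - i] gives
    [m S_m / 2]; with the recurrence this yields [(m+1) S_(m+1) = (m+1) S_m]. *)
Lemma invsqrt_coef_conv m : \sum_(i < m.+1) a i * a (m - i) = 1.
Proof.
elim: m => [|m IH]; first by rewrite big_ord1 mulr1.
have sym k : \sum_(i < k.+1) (i%:R * (a i * a (k - i))) * 2 =
    k%:R * \sum_(i < k.+1) a i * a (k - i).
  transitivity (\sum_(i < k.+1) i%:R * (a i * a (k - i)) + \sum_(i < k.+1) i%:R * (a i * a (k - i))).
    by rewrite -big_split; apply: eq_bigr => i _; rewrite mulr_natr mulr2n.
  rewrite [X in _ + X](reindex_inj rev_ord_inj) /= -big_split mulr_sumr /=.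
  apply: eq_bigr => i _; have ik : (i <= k)%N by rewrite -ltnS.
  by rewrite subSS subKn // [a (k - i) * _]mulrC -mulrDl -natrD subnKC.
have m1 : (m.+1)%:R != 0 :> R by rewrite pnatr_eq0.
apply: (mulfI m1); rewrite -sym big_ord_recl mul0r mul0r add0r mulr1.
transitivity (\sum_(i < m.+1) ((i%:R * (a i * a (m - i))) * 2 + a i * a (m - i))).
  apply: eq_bigr => i _; by rewrite lift0 subSS mulrA invsqrt_coefS; field.
by rewrite big_split /= sym IH mulr1 -[m.+1]addn1 natrD.
Qed.

Definition invsqrt_poly n : {poly R} := \poly_(k < n.+1) a k.

Lemma invsqrt_poly_sqr n : eqX n.+1 (invsqrt_poly n ^+ 2 * (1 - 'X)) 1.
Proof.
have h : eqX n.+1 (invsqrt_poly n ^+ 2) (\sum_(i < n.+1) 'X ^+ i).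
  apply/eqX_coef => i iN; rewrite expr2 coefM coef_sum.
  transitivity (1 : R).
    rewrite -(invsqrt_coef_conv i); apply: eq_bigr => j _.
    rewrite !coef_poly !ifT //; first by rewrite (leq_ltn_trans _ iN) // leq_subr.
    by rewrite (leq_trans (ltn_ord j)).
  rewrite (bigD1 (Ordinal iN)) //= big1 => [|k ki]; first by rewrite coefXn eqxx addr0.
  rewrite coefXn; case: eqVneq => // e.
  by move: ki; rewrite -val_eqE /= e eqxx.
apply: eqX_trans (eqX_mul h (eqX_refl _ _)) _.
have := subrX1 ('X : {poly R}) n.+1; rewrite -[_ - 1 as X in _ = X * _]opprB mulNr mulrC.
move=> /eqP; rewrite eq_sym eqr_oppLR opprB => /eqP ->.
by apply: eqX_mulX; rewrite dvdpNr.
Qed.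

(* Coefficients of [(1 - X/2) (1 - X)^(-1/2)]. *)
Definition half_coef (k : nat) : R := if k is k'.+1 then a k - a k' / 2 else 1.

Lemma half_coefS k : half_coef k.+1 = a k * (k%:R / (2 * k + 2)%:R).
Proof.
have k0 : 0 <= k%:R :> R by exact: ler0n.
have k2 : 2 * k%:R + 2 != 0 :> R by apply: lt0r_neq0; lra.
by rewrite /half_coef /= natrD natrM natrD natrM; field.
Qed.

Lemma half_coef_ge0 k : 0 <= half_coef k.
Proof.
case: k => [|k]; first exact: ler01.
by rewrite half_coefS mulr_ge0 ?divr_ge0 ?ler0n // ltW // invsqrt_coef_gt0.
Qed.

Definition half_poly n : {poly R} := \poly_(k < n.+1) half_coef k.

Lemma half_polyE n : eqX n.+1 (half_poly n) ((1 - (2^-1)%:P * 'X) * invsqrt_poly n).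
Proof.
apply/eqX_coef => i iN; rewrite mulrBl mul1r coefB -mulrA coefCM coefXM !coef_poly iN.
case: i iN => [|i] iN /=; first by rewrite mulr0 subr0.
by rewrite (ltnW iN) [2^-1 * _]mulrC.
Qed.

Lemma eqX_comp n (p q : {poly R}) (c : R) d : (0 < d)%N -> eqX n p q ->
  eqX n (p \Po (c%:P * 'X^d)) (q \Po (c%:P * 'X^d)).
Proof.
move=> d0 h; rewrite /eqX -comp_polyB; apply: dvdp_trans (dvdp_comp_poly _ h).
by rewrite comp_Xn_poly dvdX_exp.
Qed.

Definition placeX (w : {poly 'F_2}) : {poly R} := (2^-1 ^+ degw w)%:P * 'X^(degw w).

(* [G] restricted to the places of degree at most [n], with local factors truncated at order [N]. *)
Definition Gpoly n N : {poly R} := \prod_(w <- places n) (half_poly N \Po placeX w).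

Variable h : nat -> R.
Definition hpoly n : {poly R} := \poly_(i < n.+1) h i.

Hypothesis hPi : forall n, (0 < n)%N -> eqX n.+1 (hpoly n * (1 - 'X))
    (\prod_(w <- places n) (1 - (2^-1 * 2^-1 ^+ degw w)%:P * 'X^(degw w))).

(** Square roots with constant term [1] are unique: the squares of both sides invert [1 - X], and in
    the difference of squares the factor given by the sum has constant term [2]. *)
Lemma invsqrt_euler n N : (n <= N)%N ->
  eqX n.+1 (\prod_(w <- places n) (invsqrt_poly N \Po placeX w)) (invsqrt_poly n).
Proof.
move=> nN; set al := \prod_(w <- _) _.
have al0 : al`_0 = 1.
  rewrite -horner_coef0 horner_prod big_seq big1 // => w.
  rewrite mem_places => /andP [/placeP /degw_gt0 d0 _].
  rewrite horner_comp /placeX hornerM hornerXn expr0n eqn0Ngt d0 mulr0 horner_coef0.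
  by rewrite coef_poly.
have a0 : (invsqrt_poly n)`_0 = 1 by rewrite coef_poly.
have e1 : eqX n.+1 (al ^+ 2 * (1 - 'X)) 1.
  apply: (@eqX_trans _ _ (al ^+ 2 * \prod_(w <- places n) (1 - placeX w))).
    apply: eqX_mul; first exact: eqX_refl.
    by apply: eqX_sym; have := zeta_inv (2^-1 : R) n; rewrite mulfV ?pnatr_eq0 // polyC1 mul1r.
  rewrite /al -prodrXl -big_split /=.
  apply: (@eqX_trans _ _ (\prod_(w <- places n) 1)); last by rewrite big1 // eqX_refl.
  apply: eqX_prod => w; rewrite mem_places => /andP [/placeP /degw_gt0 d0 _].
  have := eqX_comp (2^-1 ^+ degw w) d0 (invsqrt_poly_sqr N).
  rewrite -/(placeX w) comp_polyM comp_polyB comp_polyX -[1]/(1%:P) !comp_polyC.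
  rewrite rmorphXn /=; exact: eqX_leq.
have e2 : eqX n.+1 (al ^+ 2) (invsqrt_poly n ^+ 2).
  apply: (@eqX_cancel _ _ (1 - 'X)); first by rewrite coefB coef1 coefX subr0 oner_eq0.
  exact: eqX_trans e1 (eqX_sym (invsqrt_poly_sqr n)).
apply: (@eqX_cancel _ _ (al + invsqrt_poly n)).
  by rewrite coefD al0 a0 -(natrD _ 1 1) pnatr_eq0.
move: e2; rewrite /eqX; congr (_ %| _); ring.
Qed.

Lemma Gpoly_eqX n N : (0 < n)%N -> (n <= N)%N ->
  eqX n.+1 (Gpoly n N) (hpoly n * (1 - 'X) * invsqrt_poly n).
Proof.
move=> n0 nN.
apply: (@eqX_trans _ _ (\prod_(w <- places n) ((1 - (2^-1)%:P * placeX w) * (invsqrt_poly N \Po placeX w)))).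
  apply: eqX_prod => w; rewrite mem_places => /andP [/placeP /degw_gt0 d0 _].
  have := eqX_comp (2^-1 ^+ degw w) d0 (half_polyE N).
  rewrite -/(placeX w) comp_polyM comp_polyB comp_polyM comp_polyX -[1]/(1%:P) !comp_polyC.
  exact: eqX_leq.
rewrite big_split /=; apply: eqX_mul; last exact: invsqrt_euler.
apply: eqX_trans (eqX_sym (hPi n0)); rewrite (eq_bigr (fun w => 1 - (2^-1 * 2^-1 ^+ degw w)%:P * 'X^(degw w))).
  exact: eqX_refl.
by move=> w _; rewrite /placeX mulrA -polyCM.
Qed.

(** Coefficient of [X^j] in [(1 - X)^(1/2) H], with [H] the series of [h]; cutting at [j] itself
    frees it from any external cutoff. *)
Definition gcoef j : R := (hpoly j * (1 - 'X) * invsqrt_poly j)`_j.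

Lemma gcoefE n j : (j <= n)%N -> (hpoly n * (1 - 'X) * invsqrt_poly n)`_j = gcoef j.
Proof.
move=> jn; have trunc (u : nat -> R) : eqX j.+1 (\poly_(i < n.+1) u i) (\poly_(i < j.+1) u i).
  apply/eqX_coef => i ij; rewrite !coef_poly ij ifT //.
  exact: leq_trans ij _.
have : eqX j.+1 (hpoly n * (1 - 'X) * invsqrt_poly n) (hpoly j * (1 - 'X) * invsqrt_poly j).
  by apply: eqX_mul; [apply: eqX_mul; [exact: trunc|exact: eqX_refl]|exact: trunc].
by move/eqX_coef => /(_ j (ltnSn j)).
Qed.

Lemma Gpoly_coef n N j : (0 < n)%N -> (j <= n)%N -> (n <= N)%N -> (Gpoly n N)`_j = gcoef j.
Proof.
by move=> n0 jn nN; have /eqX_coef /(_ j jn) -> := Gpoly_eqX n0 nN; exact: gcoefE.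
Qed.

Lemma h_conv M : h M = \sum_(j < M.+1) gcoef j * a (M - j).
Proof.
have : eqX M.+1 (hpoly M * (1 - 'X) * invsqrt_poly M * invsqrt_poly M) (hpoly M).
  have := eqX_mul (eqX_refl M.+1 (hpoly M)) (invsqrt_poly_sqr M).
  by rewrite mulr1; congr (eqX _ _ _); ring.
move/eqX_coef => /(_ M (ltnSn M)); rewrite [RHS]coef_poly ltnSn => <-.
rewrite coefM; apply: eq_bigr => j _; rewrite gcoefE -1?ltnS // coef_poly ifT //.
by rewrite ltnS leq_subr.
Qed.

Lemma coef_mul_ge0 (p q : {poly R}) : (forall i, 0 <= p`_i) -> (forall i, 0 <= q`_i) ->
  forall i, 0 <= (p * q)`_i.
Proof. by move=> hp hq i; rewrite coefM sumr_ge0 // => j _; exact: mulr_ge0. Qed.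

Lemma coef_comp_ge0 (p q : {poly R}) : (forall i, 0 <= p`_i) -> (forall i, 0 <= q`_i) ->
  forall i, 0 <= (p \Po q)`_i.
Proof.
move=> hp hq i; rewrite coef_comp_poly sumr_ge0 // => j _; rewrite mulr_ge0 //.
elim: (nat_of_ord j) i => [|k IH] i; first by rewrite expr0 coef1 ler0n.
by rewrite exprS; exact: coef_mul_ge0.
Qed.

Lemma Gpoly_ge0 n N j : 0 <= (Gpoly n N)`_j.
Proof.
move: j; rewrite /Gpoly; elim/big_ind: _ => [j|p q hp hq|w _].
- by rewrite coef1 ler0n.
- exact: coef_mul_ge0.
apply: coef_comp_ge0 => i; first by rewrite coef_poly; case: ifP => // _; exact: half_coef_ge0.
by rewrite coefCM coefXn mulr_ge0 ?exprn_ge0 ?invr_ge0 ?ler0n.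
Qed.

Lemma gcoef_ge0 j : 0 <= gcoef j.
Proof.
have := Gpoly_ge0 j.+1 j.+1 j; by rewrite Gpoly_coef.
Qed.

End SquareRootSeries.

(** * Wallis' bounds *)

Section Wallis.
Variable R : realType.
Local Notation a := (@invsqrt_coef R).

(** The reduction formula for primitives of [sin^n], so that Wallis' integrals are differences of
    values of explicit functions. *)
Fixpoint sin_primitive (n : nat) : R -> R :=
  match n with
  | 0 => id
  | 1 => - cos
  | (n'.+1 as m).+1 => (m.+1%:R)^-1 *: (m%:R *: sin_primitive n' - sin ^+ m * cos)
  end.

Lemma is_derive_sin_primitive n (x : R) :
  is_derive x 1 (sin_primitive n) (sin x ^+ n).
Proof.
suff : is_derive x 1 (sin_primitive n) (sin x ^+ n) /\
       is_derive x 1 (sin_primitive n.+1) (sin x ^+ n.+1) by case.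
elim: n => [|n [IH1 IH2]].
  split; first by rewrite expr0; exact: is_derive_id.
  by rewrite expr1; apply: is_derive_eq; rewrite opprK.
split=> //=.
have h1 := is_deriveX n.+1 (is_derive_sin x).
have h2 := is_deriveM h1 (is_derive_cos x).
have h3 := is_deriveB (is_deriveZ (n.+1%:R) IH1) h2.
have h4 := is_deriveZ (n.+2%:R)^-1 h3.
apply: (is_derive_eq h4).
have e := cos2Dsin2 x.
have c2 : cos x ^+ 2 = 1 - sin x ^+ 2 by rewrite -e addrK.
have n2 : (n.+2)%:R != 0 :> R by rewrite pnatr_eq0.
have -> : (n.+1)%:R = (n.+2)%:R - 1 :> R by rewrite -[n.+2]addn1 natrD addrK.
apply: (mulfI n2); rewrite /GRing.scale /= !fctE mulVKf // !exprS.
by move: c2; rewrite expr2; move: (cos x) (sin x) (sin x ^+ n) ((n.+2)%:R : R) => c s p m c2; ring: c2.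
Qed.

Let I n := sin_primitive n (pi / 2) - sin_primitive n 0.

Lemma sin_integral_rec n : I n.+2 = (n.+1)%:R / (n.+2)%:R * I n.
Proof.
rewrite /I /= !fctE /GRing.scale /= cos_pihalf sin0 expr0n /= mulr0 mul0r !subr0.
by rewrite -mulrBr -mulrBr mulrA [_^-1 * _]mulrC.
Qed.

(** By the mean value theorem the difference is [pi / 2] times a value of [sin^n (1 - sin)]. *)
Lemma sin_integral_decr n : I n.+1 <= I n.
Proof.
have pi0 : 0 <= pi / 2 :> R by rewrite divr_ge0 ?pi_ge0.
have dD (x : R) : is_derive x 1 (sin_primitive n - sin_primitive n.+1) (sin x ^+ n - sin x ^+ n.+1).
  by apply: is_deriveB; exact: is_derive_sin_primitive.
have [|c cI e] := @MVT_segment _ _ (fun x => sin x ^+ n - sin x ^+ n.+1) _ _ pi0.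
  apply: continuous_subspaceT => x; apply: differentiable_continuous; apply/derivable1_diffP.
  by have [] := dD x.
move: e; rewrite /I !fctE -subr_ge0 => e.
have -> : forall s s' t t' : R, s - s' - (t - t') = (s - t) - (s' - t') by move=> *; ring.
rewrite e subr0 mulr_ge0 // exprS -{1}[sin c ^+ n]mul1r -mulrBl.
rewrite mulr_ge0 ?subr_ge0 ?sin_le1 // exprn_ge0 // sin_ge0_pi //.
move: cI; rewrite in_itv /= => /andP [-> /le_trans -> //].
by have := pi_ge0 R; lra.
Qed.

Lemma sin_integral_even n : I n.*2 = a n * (pi / 2).
Proof.
elim: n => [|n IH]; first by rewrite /I /= subr0 mul1r.
rewrite doubleS sin_integral_rec IH /= -mul2n addn1 addn2.
have n0 : 0 <= n%:R :> R by exact: ler0n.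
by field; do ?[apply/andP; split]; apply: lt0r_neq0; lra.
Qed.

Lemma sin_integral_odd n : (n.*2.+1)%:R * a n * I n.*2.+1 = 1.
Proof.
elim: n => [|n IH]; first by rewrite /I /= !fctE cos_pihalf cos0 oppr0 opprK add0r !mulr1.
rewrite doubleS sin_integral_rec -[RHS]IH /= -mul2n addn1 addn2.
have n0 : 0 <= n%:R :> R by exact: ler0n.
by field; do ?[apply/andP; split]; apply: lt0r_neq0; lra.
Qed.

(** This is [I (2n+1) <= I (2n)] multiplied by [(2n + 1) a n]; the upper bound uses
    [I (2n+2) <= I (2n+1)] in the same way. *)
Lemma wallis_lower n : 1 <= pi * (n%:R + 2^-1) * a n ^+ 2.
Proof.
have := sin_integral_decr n.*2; rewrite sin_integral_even => h.
have a0 := invsqrt_coef_gt0 R n.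
have p0 : 0 < (n.*2.+1)%:R * a n by rewrite mulr_gt0 ?ltr0n.
rewrite -(ler_pM2l p0) sin_integral_odd in h; apply: le_trans h _.
rewrite -mul2n -addn1 natrD natrM le_eqVlt; apply/orP; left; apply/eqP; by field.
Qed.

Lemma wallis_upper n : pi * (n.+1)%:R * a n.+1 ^+ 2 <= 1.
Proof.
have := sin_integral_decr n.*2.+1; rewrite -doubleS sin_integral_even => h.
have a0 := invsqrt_coef_gt0 R n.
have p0 : 0 < (n.*2.+1)%:R * a n by rewrite mulr_gt0 ?ltr0n.
rewrite -(ler_pM2l p0) sin_integral_odd in h; apply: le_trans h.
have := invsqrt_coefS R n; rewrite -mul2n -[(2 * n).+1]addn1 natrD natrM => e.
have -> : (2 * n%:R + 1) * a n = 2 * ((n.+1)%:R * a n.+1) by rewrite e; field.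
by rewrite le_eqVlt; apply/orP; left; apply/eqP; field.
Qed.

End Wallis.

Arguments invsqrt_coef : simpl never.
Arguments half_coef : simpl never.

(** * Absolute convergence at 5/4 *)

Section Bounds.
Variable R : realType.
Local Notation a := (@invsqrt_coef R).

Lemma invsqrt_coef_le1 k : a k <= 1.
Proof.
elim: k => [|k IH] //; have := invsqrt_coefS R k; have := invsqrt_coef_gt0 R k.
have : 0 <= k%:R :> R by exact: ler0n.
rewrite -[k.+1]addn1 natrD; move: (a k) (a _) (k%:R : R) IH => u v x; nra.
Qed.

Lemma invsqrt_coefS_le k : a k.+1 <= 2^-1.
Proof.
elim: k => [|k IH].
  by have := invsqrt_coefS R 0; rewrite mul1r add0r mulr1 => ->.
have := invsqrt_coefS R k.+1; have := invsqrt_coef_gt0 R k.+1.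
have : 0 <= k.+1%:R :> R by exact: ler0n.
rewrite -[k.+2]addn1 natrD; move: (a _) (a _) (k.+1%:R : R) IH => u v x; nra.
Qed.

Lemma half_coefSS_le k : half_coef R k.+2 <= 4^-1.
Proof.
rewrite half_coefS.
have h : (k.+1)%:R / (2 * k.+1 + 2)%:R <= 2^-1 :> R.
  have p : 0 < (2 * k.+1 + 2)%:R :> R by rewrite ltr0n addn2.
  rewrite ler_pdivrMr // natrD natrM.
  have : 0 <= k.+1%:R :> R by exact: ler0n.
  lra.
have h0 : 0 <= (k.+1)%:R / (2 * k.+1 + 2)%:R :> R by rewrite divr_ge0 ?ler0n.
have := invsqrt_coefS_le k; have := invsqrt_coef_gt0 R k.+1.
move: (a _) (_ / _) h h0 => u v; nra.
Qed.

(** [5/8] is the largest value of [X_w] at [5/4], attained in degree one. *)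
Lemma half_poly_le N x : 0 <= x -> x <= 5 / 8 -> (half_poly R N).[x] <= 1 + x ^+ 2.
Proof.
move=> x0 x1; rewrite horner_poly.
(* The coefficients are at most [1/4], and [(1/4) / (1 - 5/8) = 2/3] bounds the geometric tail; the
   induction needs exactly [1/4 + 2x/3 <= 2/3]. *)
have claim M : \sum_(i < M.+2) half_coef R i * x ^+ i + 2 / 3 * x ^+ M.+2 <= 1 + 2 / 3 * x ^+ 2.
  elim: M => [|M IH].
    rewrite big_ord_recl big_ord1 /= half_coefS mul0r mulr0 mul0r addr0 expr0 mulr1.
    exact: lexx.
  rewrite big_ord_recr /=; have := half_coefSS_le M; have : 0 <= x ^+ M.+2 by exact: exprn_ge0.
  move: IH; rewrite [x ^+ M.+3]exprS -/(half_coef R M.+2).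
  move: (\sum_(i < M.+2) _) (x ^+ M.+2) (half_coef R M.+2) => s y e; nra.
case: N => [|N]; first by rewrite big_ord1 mulr1 lerDl sqr_ge0.
have := claim N; have : 0 <= x ^+ N.+2 by exact: exprn_ge0.
move: (\sum_(i < N.+2) _) (x ^+ N.+2) => s y; nra.
Qed.

Lemma sum_places_le (y : R) n : 0 <= y -> 2 * y < 1 ->
  \sum_(w <- places n) y ^+ degw w <= (1 - 2 * y)^-1.
Proof.
move=> y0 y1; rewrite /places big_filter big_mkcond big_polys /=; last first.
  by case: placeP => // /irredp_neq0; rewrite eqxx.
apply: (@le_trans _ _ (\sum_(m < n.+1) (2 * y) ^+ m)).
  apply: ler_sum => m _; rewrite big_seq.
  apply: (@le_trans _ _ (\sum_(b <- deg_polys m | b \in deg_polys m) y ^+ m)).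
    apply: ler_sum => b; rewrite mem_deg_polys => /eqP sb.
    by case: ifP => _; rewrite ?exprn_ge0 // /degw sb.
  by rewrite -big_seq big_const_seq count_predT size_deg_polys iter_addr addr0 -[leLHS]mulr_natl natrX exprMn.
have p : 0 < 1 - 2 * y by rewrite subr_gt0.
have := subrX1 (2 * y) n.+1; set s := \sum_(i < _) _ => e.
have z0 : 0 <= (2 * y) ^+ n.+1 by rewrite exprn_ge0 // mulr_ge0.
have es : s * (1 - 2 * y) = 1 - (2 * y) ^+ n.+1.
  by rewrite -[RHS]opprB e; ring.
by rewrite -[leRHS]mul1r (ler_pdivlMr _ _ p) es gerBl.
Qed.

Lemma prod_le_expR (s : seq {poly 'F_2}) (u : {poly 'F_2} -> R) : (forall w, 0 <= u w) ->
  \prod_(w <- s) (1 + u w) <= expR (\sum_(w <- s) u w).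
Proof.
move=> u0; elim: s => [|w s IH]; first by rewrite !big_nil expR0.
rewrite !big_cons expRD ler_pM ?expR_ge1Dx // ?addr_ge0 //.
by apply: prodr_ge0 => v _; rewrite addr_ge0.
Qed.

Lemma prod_places_le (y : R) n : 0 <= y -> 2 * y < 1 ->
  \prod_(w <- places n) (1 + y ^+ degw w) <= expR (1 - 2 * y)^-1.
Proof.
move=> y0 y1; apply: le_trans (prod_le_expR _ _) _ => [w|]; first exact: exprn_ge0.
by rewrite ler_expR sum_places_le.
Qed.

Lemma quadratic_le_pow j : j%:R * (j.+1)%:R <= 64 * (5 / 4) ^+ j :> R.
Proof.
(* The first three terms of the binomial expansion of [(1 + 1/4)^j]. *)
have claim : 1 + j%:R / 4 + j%:R * (j%:R - 1) / 32 <= (5 / 4) ^+ j :> R.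
  elim: j => [|j IH]; first by rewrite !mul0r !addr0.
  have j0 : 0 <= j%:R * (j%:R - 1) :> R.
    by case: j {IH} => [|j]; rewrite ?mul0r // mulr_ge0 ?ler0n // subr_ge0 ler1n.
  rewrite exprS -[j.+1]addn1 natrD; move: (_ ^+ j) (j%:R : R) j0 IH => y x; nra.
have : 0 <= j%:R :> R by exact: ler0n.
rewrite -[j.+1]addn1 natrD; move: (_ ^+ j) (j%:R : R) claim => y x; nra.
Qed.

(** For [j > n] one has [1 <= (5/4)^j (4/5)^(n+1)], so the value of [q] at [5/4] controls the tail
    at [1]. *)
Lemma coef_tail (p q : {poly R}) C n : (forall i, `|p`_i| <= q`_i) -> q.[5 / 4] <= C ->
  `|p.[1] - \sum_(j < n.+1) p`_j| <= C * (4 / 5) ^+ n.+1.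
Proof.
move=> pq qC; pose N := (n.+1 + (size p + size q))%N.
have pN : p.[1] = \sum_(j < N) p`_j.
  rewrite (@horner_coef_wide _ N) ?/N; last by rewrite addnCA leq_addr.
  by apply: eq_bigr => j _; rewrite expr1n mulr1.
have qN : q.[5 / 4] = \sum_(j < N) q`_j * (5 / 4) ^+ j.
  by rewrite (@horner_coef_wide _ N) // /N addnA leq_addl.
have q0 j : 0 <= q`_j by apply: le_trans (pq j).
have x0 : 0 <= (5 / 4 : R) by lra.
rewrite pN big_split_ord /= addrAC subrr add0r.
apply: le_trans (ler_norm_sum _ _ _) _.
apply: (@le_trans _ _ (\sum_(j < size p + size q) q`_(n.+1 + j) * (5 / 4) ^+ (n.+1 + j) * (4 / 5) ^+ n.+1)).
  apply: ler_sum => j _; apply: le_trans (pq _) _.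
  rewrite -mulrA ler_peMr // exprD mulrAC -exprMn.
  rewrite (_ : 5 / 4 * (4 / 5) = 1 :> R) ?expr1n ?mul1r; last by field.
  by rewrite exprn_ege1 //; lra.
have y0 : 0 <= (4 / 5 : R) ^+ n.+1 by apply: exprn_ge0; lra.
rewrite -mulr_suml; apply: (ler_wpM2r y0).
apply: le_trans qC; rewrite qN [leRHS]big_split_ord /= lerDr sumr_ge0 // => j _.
by rewrite mulr_ge0 // exprn_ge0.
Qed.

Lemma coef_prod_norm_le (s : seq {poly 'F_2}) (f g : {poly 'F_2} -> {poly R}) :
  (forall w i, `|(f w)`_i| <= (g w)`_i) ->
  forall i, `|(\prod_(w <- s) f w)`_i| <= (\prod_(w <- s) g w)`_i.
Proof.
move=> fg; elim: s => [|w s IH] i; first by rewrite !big_nil coef1 normr_nat.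
rewrite !big_cons !coefM; apply: le_trans (ler_norm_sum _ _ _) _.
by apply: ler_sum => j _; rewrite normrM ler_pM.
Qed.

(** By [zeta_inv] at [1/4] the coefficients up to [n] are those of [1 - X/2], with sum [1/2] once
    [n >= 1]. In the tail, [5/16 = 1/4 * 5/4]. *)
Lemma zeta2_partial n : (0 < n)%N ->
  `|\prod_(w <- places n) (1 - 4^-1 ^+ degw w) - 2^-1|
    <= expR (1 - 2 * (5 / 16))^-1 * (4 / 5) ^+ n.+1 :> R.
Proof.
move=> n0; pose u w : {poly R} := (4^-1 ^+ degw w)%:P * 'X^(degw w).
have dom : forall i, `|(\prod_(w <- places n) (1 - u w))`_i| <= (\prod_(w <- places n) (1 + u w))`_i.
  apply: coef_prod_norm_le => w i; rewrite coefB coefD coef1 /u coefCM coefXn.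
  apply: le_trans (ler_normB _ _) _.
  by rewrite normr_nat ger0_norm // mulr_ge0 ?exprn_ge0 ?invr_ge0 ?ler0n.
have := @coef_tail _ _ (expR (1 - 2 * (5 / 16))^-1) n dom.
have -> : (\prod_(w <- places n) (1 - u w)).[1] = \prod_(w <- places n) (1 - 4^-1 ^+ degw w).
  rewrite horner_prod; apply: eq_bigr => w _.
  by rewrite /u !(hornerE, hornerXn) expr1n mulr1.
have -> : \sum_(j < n.+1) (\prod_(w <- places n) (1 - u w))`_j = 2^-1.
  have /eqX_coef e := zeta_inv (4^-1 : R) n.
  rewrite (eq_bigr (fun j : 'I_n.+1 => (1 - (2 / 4)%:P * 'X : {poly R})`_j)); last first.
    by move=> j _; rewrite e.
  case: n n0 {dom e} => // n _.
  rewrite 2!big_ord_recl big1 ?addr0 => [|j _]; rewrite !(coefB, coef1, coefCM, coefX) /=.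
    by rewrite ?mulr0 ?subr0 ?mulr1; field.
  by rewrite mulr0 subrr.
apply; rewrite horner_prod.
rewrite (eq_bigr (fun w => 1 + (5 / 16) ^+ degw w)); first by apply: prod_places_le; lra.
by move=> w _; rewrite /u !(hornerE, hornerXn) -exprMn; congr (1 + _ ^+ _); field.
Qed.

Variable h : nat -> R.
Hypothesis hPi : forall n, (0 < n)%N -> eqX n.+1 (hpoly h n * (1 - 'X))
    (\prod_(w <- places n) (1 - (2^-1 * 2^-1 ^+ degw w)%:P * 'X^(degw w))).

(** At [5/4] a local factor is at most [1 + (25/64)^d], where [25/64 = (5/8)^2]. *)
Definition Gbound : R := expR (1 - 2 * (25 / 64))^-1.

Lemma Gbound_gt0 : 0 < Gbound.
Proof. exact: expR_gt0. Qed.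

Lemma Gpoly_bound n N : (Gpoly R n N).[5 / 4] <= Gbound.
Proof.
rewrite /Gpoly horner_prod; apply: le_trans (@prod_places_le (25 / 64) n _ _); try by lra.
rewrite big_seq [leRHS]big_seq; apply: ler_prod => w.
rewrite mem_places => /andP [/placeP /degw_gt0 d0 _].
rewrite horner_comp /placeX !(hornerE, hornerXn) -exprMn.
rewrite (_ : 2^-1 * (5 / 4) = 5 / 8 :> R); last by field.
have x0 : 0 <= (5 / 8 : R) ^+ degw w by apply: exprn_ge0; lra.
have x1 : (5 / 8 : R) ^+ degw w <= 5 / 8.
  by rewrite -{2}[5 / 8]expr1; apply: ler_wiXn2l => //; lra.
apply/andP; split.
  rewrite horner_poly sumr_ge0 // => i _.
  by rewrite mulr_ge0 ?exprn_ge0 // half_coef_ge0.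
apply: le_trans (half_poly_le _ x0 x1) _; rewrite -exprM mulnC exprM.
by rewrite (_ : (5 / 8) ^+ 2 = 25 / 64 :> R) //; field.
Qed.

Lemma Gpoly_tail n N : (0 < n)%N -> (n <= N)%N ->
  `|(Gpoly R n N).[1] - \sum_(j < n.+1) gcoef h j| <= Gbound * (4 / 5) ^+ n.+1.
Proof.
move=> n0 nN; have := @coef_tail (Gpoly R n N) (Gpoly R n N) Gbound n.
rewrite (eq_bigr (fun j : 'I_n.+1 => gcoef h j)) => [|j _]; last first.
  by rewrite (Gpoly_coef hPi) // -ltnS.
by apply; [move=> i; rewrite ger0_norm // Gpoly_ge0 | exact: Gpoly_bound].
Qed.

Lemma gcoef_weighted n : \sum_(j < n.+1) gcoef h j * (5 / 4) ^+ j <= Gbound.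
Proof.
have main m : \sum_(j < m.+2) gcoef h j * (5 / 4) ^+ j <= Gbound.
  apply: le_trans (Gpoly_bound m.+1 m.+1); pose N := (m.+2 + size (Gpoly R m.+1 m.+1))%N.
  rewrite (@horner_coef_wide _ N) ?/N; last by rewrite leq_addl.
  rewrite big_split_ord /= -[leLHS]addr0 lerD //; last first.
    by apply: sumr_ge0 => j _; rewrite mulr_ge0 ?exprn_ge0 ?Gpoly_ge0 //; lra.
  by apply: ler_sum => j _; rewrite (Gpoly_coef hPi) // -ltnS.
case: n => [|n]; last exact: main.
apply: le_trans (main 0%N); rewrite [leRHS]big_ord_recr /= lerDl mulr_ge0 ?exprn_ge0 //.
exact: gcoef_ge0.
Qed.

End Bounds.

Local Open Scope classical_set_scope.

(** * Limits of the truncated Euler products *)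

Section Limits.
Variable R : realType.
Local Notation a := (@invsqrt_coef R).

Lemma geometric_sum (x : R) m : (\sum_(k < m) x ^+ k) * (1 - x) = 1 - x ^+ m.
Proof. by rewrite -[RHS]opprB subrX1 -mulNr opprB mulrC. Qed.

(** The coefficients of the square are [1] up to [N] and lie in [[0, 1]] afterwards, so its value
    lies between two geometric sums. *)
Lemma invsqrt_poly_bounds N (x : R) : 0 <= x -> x < 1 ->
  (1 - x ^+ N.+1) / (1 - x) <= (invsqrt_poly R N).[x] ^+ 2 <= (1 - x)^-1.
Proof.
move=> x0 x1; have p : 0 < 1 - x by rewrite subr_gt0.
have a0 k : 0 <= a k by exact/ltW/invsqrt_coef_gt0.
have c1 k : ((invsqrt_poly R N) ^+ 2)`_k <= 1.
  rewrite expr2 coefM -(invsqrt_coef_conv R k); apply: ler_sum => i _.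
  by rewrite !coef_poly; do 2 case: ifP => _; rewrite ?mulr0 ?mul0r // ?mulr_ge0.
have c0 k : 0 <= ((invsqrt_poly R N) ^+ 2)`_k.
  rewrite expr2 coefM sumr_ge0 // => i _.
  by rewrite !coef_poly; do 2 case: ifP => _; rewrite ?mulr0 ?mul0r // ?mulr_ge0.
have ce k : (k < N.+1)%N -> ((invsqrt_poly R N) ^+ 2)`_k = 1.
  move=> kN; rewrite expr2 coefM -(invsqrt_coef_conv R k); apply: eq_bigr => i _.
  rewrite !coef_poly !ifT //; first by rewrite (leq_ltn_trans _ kN) // leq_subr.
  by rewrite (leq_trans (ltn_ord i)).
rewrite -horner_exp; set q := _ ^+ 2; pose m := (N.+1 + size q)%N.
rewrite (@horner_coef_wide _ m); last by rewrite leq_addl.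
apply/andP; split.
  rewrite ler_pdivrMr // -geometric_sum; apply: (ler_wpM2r (ltW p)).
  rewrite [leRHS]big_split_ord /= -[leLHS]addr0.
  rewrite lerD //; last by rewrite sumr_ge0 // => i _; rewrite mulr_ge0 ?exprn_ge0.
  by apply: ler_sum => i _; rewrite ce // mul1r.
rewrite -[leRHS]mul1r ler_pdivlMr //.
apply: (@le_trans _ _ ((\sum_(k < m) x ^+ k) * (1 - x))).
  apply: (ler_wpM2r (ltW p)); apply: ler_sum => i _.
  by rewrite -[leRHS]mul1r ler_wpM2r ?exprn_ge0.
by rewrite geometric_sum gerBl exprn_ge0.
Qed.

Lemma expr_cvg0 (x : R) : 0 <= x -> x < 1 -> x ^+ n @[n --> \oo] --> (0 : R).
Proof. by move=> x0 x1; apply: cvg_expr; rewrite ger0_norm. Qed.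

Lemma invsqrt_poly_cvg (x : R) : 0 <= x -> x < 1 ->
  (invsqrt_poly R N).[x] @[N --> \oo] --> (Num.sqrt (1 - x))^-1.
Proof.
move=> x0 x1; have p : 0 < 1 - x by rewrite subr_gt0.
have sq : (invsqrt_poly R N).[x] ^+ 2 @[N --> \oo] --> (1 - x)^-1.
  apply: (@squeeze_cvgr _ _ _ _ (fun N => (1 - x * x ^+ N) / (1 - x)) (fun=> (1 - x)^-1)).
  - by exists 0%N => // N _; rewrite -exprS invsqrt_poly_bounds.
  - have : (1 - x * x ^+ N) / (1 - x) @[N --> \oo] --> (1 - x * 0) / (1 - x).
      apply: cvgM; last exact: cvg_cst.
      apply: cvgB; first exact: cvg_cst.
      by apply: cvgM; [exact: cvg_cst | exact: expr_cvg0].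
    by rewrite mulr0 subr0 mul1r.
  - exact: cvg_cst.
rewrite -sqrtrV ?ltW //.
have -> : (fun N => (invsqrt_poly R N).[x]) = (fun N => Num.sqrt ((invsqrt_poly R N).[x] ^+ 2)).
  apply/funext => N; rewrite sqrtr_sqr ger0_norm // horner_poly sumr_ge0 // => i _.
  by rewrite mulr_ge0 ?exprn_ge0 // ltW // invsqrt_coef_gt0.
by apply: (continuous_cvg _ _ sq); exact: sqrt_continuous.
Qed.

Lemma half_poly_horner N (x : R) :
  (half_poly R N).[x] = (1 - x / 2) * (invsqrt_poly R N).[x] + 2^-1 * a N * x ^+ N.+1.
Proof.
elim: N => [|N IH].
  rewrite !horner_poly !big_ord1 /= -[invsqrt_coef R 0]/(1 : R) -[half_coef R 0]/(1 : R) expr0 expr1.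
  by field.
move: IH; rewrite !horner_poly => IH.
rewrite big_ord_recr IH [in RHS]big_ord_recr /=.
by rewrite [x ^+ N.+2]exprS -[half_coef _ _]/(a N.+1 - a N / 2); field.
Qed.

Definition half_series (x : R) : R := (1 - x / 2) / Num.sqrt (1 - x).

Lemma half_poly_cvg (x : R) : 0 <= x -> x < 1 ->
  (half_poly R N).[x] @[N --> \oo] --> half_series x.
Proof.
move=> x0 x1; rewrite /half_series -[(1 - x / 2) / _]addr0.
under eq_fun do rewrite half_poly_horner.
apply: cvgD; first by apply: cvgM; [exact: cvg_cst | exact: invsqrt_poly_cvg].
apply: (@squeeze_cvgr _ _ _ _ (fun=> 0) (fun N => x ^+ N)); [|exact: cvg_cst|exact: expr_cvg0].
exists 0%N => // N _; have := invsqrt_coef_gt0 R N; have := invsqrt_coef_le1 R N.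
have : 0 <= x ^+ N by exact: exprn_ge0.
rewrite exprS; move: (a N) (x ^+ N) => u y y0 u1 u0.
have h : 0 <= u * x <= 1 by apply/andP; split; nra.
rewrite (_ : 2^-1 * u * (x * y) = 2^-1 * (u * x) * y); last by ring.
move: (u * x) h => v h; nra.
Qed.

Definition half_product n : R := \prod_(w <- places n) half_series (2^-1 ^+ degw w).

Lemma Gpoly_cvg n : (Gpoly R n N).[1] @[N --> \oo] --> half_product n.
Proof.
rewrite /half_product; under eq_fun do rewrite /Gpoly horner_prod.
have : forall w, w \in places n -> irreducible_poly w.
  by move=> w; rewrite mem_places => /andP [/placeP].
elim: (places n) => [|w s IH] hs.
  by rewrite big_nil; under eq_fun do rewrite big_nil; exact: cvg_cst.
rewrite big_cons.
have -> : (fun N => \prod_(v <- w :: s) (half_poly R N \Po placeX R v).[1]) =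
  (fun N => (half_poly R N \Po placeX R w).[1] * \prod_(v <- s) (half_poly R N \Po placeX R v).[1]).
  by apply/funext => N; rewrite big_cons.
apply: cvgM; last by apply: IH => v vs; apply: hs; rewrite inE vs orbT.
have d0 : (0 < degw w)%N by apply/degw_gt0/hs; rewrite mem_head.
under eq_fun do rewrite horner_comp /placeX hornerM hornerC hornerXn expr1n mulr1.
apply: half_poly_cvg; first by rewrite exprn_ge0 // invr_ge0.
by rewrite exprn_ilt1 ?invr_ge0 // ?invf_lt1 ?ltr1n // -lt0n.
Qed.

Lemma cvg_geometric_close (u v : nat -> R) (C l : R) :
  (forall n, (0 < n)%N -> `|u n - v n| <= C * (4 / 5) ^+ n.+1) ->
  v n @[n --> \oo] --> l -> u n @[n --> \oo] --> l.
Proof.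
move=> uv vl; have -> : u = (fun n => (u n - v n) + v n) by apply/funext => n; rewrite subrK.
rewrite -[l]add0r; apply: cvgD => //.
have z : C * (4 / 5) ^+ n.+1 @[n --> \oo] --> (0 : R).
  have : C * (4 / 5) * (4 / 5) ^+ n @[n --> \oo] --> C * (4 / 5) * 0.
    by apply: cvgM; [exact: cvg_cst | apply: expr_cvg0; lra].
  by rewrite mulr0; under eq_fun do rewrite -mulrA -exprS.
apply: (@squeeze_cvgr _ _ _ _ (fun n => - (C * (4 / 5) ^+ n.+1)) (fun n => C * (4 / 5) ^+ n.+1)) => //.
  by exists 1%N => // n /= n0; rewrite -ler_norml uv.
by rewrite -oppr0; exact: cvgN.
Qed.

Variable h : nat -> R.
Hypothesis hPi : forall n, (0 < n)%N -> eqX n.+1 (hpoly h n * (1 - 'X))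
    (\prod_(w <- places n) (1 - (2^-1 * 2^-1 ^+ degw w)%:P * 'X^(degw w))).

Definition gsum n : R := \sum_(j < n.+1) gcoef h j.

Lemma gsum_tail m k : gsum (m + k) <= gsum m + Gbound R * (4 / 5) ^+ m.+1.
Proof.
have g0 := gcoef_ge0 hPi.
rewrite /gsum -addSn big_split_ord /= lerD2l.
have x0 : 0 <= (5 / 4 : R) by lra.
have y0 : 0 <= (4 / 5 : R) ^+ m.+1 by apply: exprn_ge0; lra.
apply: (@le_trans _ _ (\sum_(j < k) gcoef h (m.+1 + j) * (5 / 4) ^+ (m.+1 + j) * (4 / 5) ^+ m.+1)).
  apply: ler_sum => j _; rewrite -mulrA ler_peMr // exprD mulrAC -exprMn.
  rewrite (_ : 5 / 4 * (4 / 5) = 1 :> R) ?expr1n ?mul1r; last by field.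
  by rewrite exprn_ege1 //; lra.
rewrite -mulr_suml; apply: (ler_wpM2r y0).
apply: le_trans (gcoef_weighted hPi (m + k)); rewrite -addSn [leRHS]big_split_ord /= lerDr.
by rewrite sumr_ge0 // => j _; rewrite mulr_ge0 ?exprn_ge0.
Qed.

Lemma gsum_ndecr : nondecreasing_seq gsum.
Proof.
apply/nondecreasing_seqP => n; rewrite /gsum [leRHS]big_ord_recr /= lerDl.
exact: gcoef_ge0.
Qed.

Lemma gsum_cvg : cvgn gsum.
Proof.
apply: nondecreasing_is_cvgn; first exact: gsum_ndecr.
exists (gsum 0 + Gbound R * (4 / 5) ^+ 1) => _ [n _ <-].
by have := gsum_tail 0 n; rewrite add0n.
Qed.

Definition glim : R := limn gsum.

Lemma gsum_le_glim n : gsum n <= glim.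
Proof. exact: nondecreasing_cvgn_le gsum_ndecr gsum_cvg n. Qed.

Lemma glim_tail m : glim <= gsum m + Gbound R * (4 / 5) ^+ m.+1.
Proof.
apply: limr_le; first exact: gsum_cvg.
exists m => // n /= mn; rewrite -(subnKC mn); exact: gsum_tail.
Qed.

(** [Gpoly_tail] is uniform in [N], so [N] may tend to infinity at fixed [n], and [n] afterwards. *)
Lemma half_product_cvg : half_product n @[n --> \oo] --> glim.
Proof.
apply: (@cvg_geometric_close _ gsum (Gbound R)) => [n n0|]; last exact: gsum_cvg.
have c : `|(Gpoly R n N).[1] - gsum n| @[N --> \oo] --> `|half_product n - gsum n|.
  by apply: cvg_norm; apply: cvgB; [exact: Gpoly_cvg | exact: cvg_cst].
apply: (cvgr_to_le c); exists n => // N /= nN.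
exact: Gpoly_tail.
Qed.

Lemma zeta2_cvg : \prod_(w <- places n) (1 - 4^-1 ^+ degw w) @[n --> \oo] --> (2^-1 : R).
Proof.
apply: (@cvg_geometric_close _ (fun=> 2^-1)); last exact: cvg_cst.
exact: zeta2_partial.
Qed.

End Limits.

(** * The constant and the asymptotic formula *)

Section Constant.
Variable R : realType.

(** The general formula would give [9/8] at [t]; the factor [2/3] turns it into [3/4]. *)
Lemma c_finE (w : {poly 'F_2}) : irreducible_poly w ->
  let x : R := 2^-1 ^+ degw w in
  c_fin R w = (1 + x) * (1 - x / 2) * (if w == 'X then 2 / 3 else 1).
Proof.
move=> wi x; rewrite /c_fin; case: eqVneq => [wX|wX].
  by rewrite /x wX /degw size_polyX expr1; field.
have [d dE] : exists d, degw w = d.+1 by exists (degw w).-1; rewrite prednK // degw_gt0.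
have -> : (2 * degw w - 1 = (d + d).+1)%N by rewrite dE; lia.
rewrite /x dE exprVn !exprS exprD.
have q1 : 1 <= 2 ^+ d :> R by rewrite exprn_ege1 // ler1n.
move: (2 ^+ d) q1 => q q1.
field; apply/andP; split; apply: lt0r_neq0; lra.
Qed.

(** [(1 - x)^(1/2) (1 + x) (1 - x/2) = (1 - x^2) (1 - x/2) (1 - x)^(-1/2)]; the constants [3/4] at
    infinity and [2/3] at [t] multiply to [1/2]. *)
Lemma cpartE n : (0 < n)%N ->
  cpart R n = Num.sqrt 2^-1 / 2 *
    (\prod_(w <- places n) (1 - 4^-1 ^+ degw w) * half_product R n).
Proof.
move=> n0; rewrite /cpart.
rewrite (big_places _ (fun w => (1 - (2 ^+ degw w)^-1) `^ (2^-1) * c_fin R w)).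
have -> : (1 - 2^-1) `^ (2^-1) * c_inf R = Num.sqrt 2^-1 * (3 / 4).
  have -> : 1 - 2^-1 = 2^-1 :> R by field.
  by rewrite powR12_sqrt ?invr_ge0 // /c_inf; congr (_ * _); field.
pose corr (w : {poly 'F_2}) : R := if w == 'X then 2 / 3 else 1.
have -> : \prod_(w <- places n) ((1 - (2 ^+ degw w)^-1) `^ (2^-1) * c_fin R w) =
  \prod_(w <- places n) (((1 - 4^-1 ^+ degw w) * half_series (2^-1 ^+ degw w)) * corr w).
  rewrite big_seq [RHS]big_seq; apply: eq_bigr => w.
  rewrite mem_places => /andP [/placeP wi _]; have d0 := degw_gt0 wi.
  rewrite c_finE // -/(corr w) mulrA; congr (_ * _).
  have -> : 4^-1 ^+ degw w = (2^-1 ^+ degw w) ^+ 2 :> R.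
    by rewrite -exprM mulnC exprM; congr (_ ^+ _); field.
  rewrite -exprVn /half_series.
  have : (2^-1 : R) ^+ degw w < 1.
    by rewrite exprn_ilt1 ?invr_ge0 // ?invf_lt1 ?ltr1n // -lt0n.
  move: (2^-1 ^+ degw w) => x x1.
  have p : 0 < 1 - x by rewrite subr_gt0.
  rewrite powR12_sqrt; last exact: ltW.
  have s0 : 0 < Num.sqrt (1 - x) by rewrite sqrtr_gt0.
  have s2 : Num.sqrt (1 - x) ^+ 2 = 1 - x by rewrite sqr_sqrtr // ltW.
  move: (Num.sqrt (1 - x)) s0 s2 => s s0 s2.
  have sn : s != 0 by exact: lt0r_neq0.
  apply: (mulIf sn); rewrite -[RHS]mulrA divfK //.
  transitivity (s ^+ 2 * ((1 + x) * (1 - x / 2))); first by ring.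
  by rewrite s2; ring.
rewrite big_split /= big_split /= -/(half_product R n).
have -> : \prod_(w <- places n) corr w = 2 / 3.
  rewrite (bigD1_seq 'X) ?places_uniq //=; last first.
    by rewrite mem_places size_polyX ltnS n0 andbT; apply/placeP; exact: irredp_X.
  rewrite {1}/corr eqxx big1 ?mulr1 // => w /negPf wX.
  by rewrite /corr wX.
by field.
Qed.

End Constant.

(** * Asymptotics of the counting coefficients *)

Section Asymptotics.
Variable R : realType.
Local Notation a := (@invsqrt_coef R).

Lemma invsqrt_coef_decr m n : (m <= n)%N -> a n <= a m.
Proof.
move=> mn; rewrite -(subnKC mn); elim: (n - m)%N => [|k IH]; first by rewrite addn0.
rewrite addnS; apply: le_trans IH.
have := invsqrt_coefS R (m + k); have := invsqrt_coef_gt0 R (m + k).+1.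
have := invsqrt_coef_gt0 R (m + k).
have : 0 <= (m + k)%:R :> R by exact: ler0n.
rewrite -[(m + k).+1]addn1 natrD; move: (a _) (a _) ((m + k)%:R : R) => u v x; nra.
Qed.

Lemma mul_invsqrt_coef_incr m n : (m <= n)%N -> m%:R * a m <= n%:R * a n.
Proof.
move=> mn; rewrite -(subnKC mn); elim: (n - m)%N => [|k IH]; first by rewrite addn0.
rewrite addnS; apply: le_trans IH _; rewrite invsqrt_coefS.
by rewrite ler_wpM2r ?lerDl ?invr_ge0 // ltW // invsqrt_coef_gt0.
Qed.

(** As [m a m] increases, [k = M - j] satisfies [k (a k - a M) <= j a M]; for [k >= 1],
    [M <= 2 k (j + 1)] trades [1 / k] for [2 (j + 1) / M]. At [k = 0] the bound [M a M >= a 1 = 1/2]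
    takes over. *)
Lemma invsqrt_coef_shift M j : (0 < M)%N -> (j <= M)%N ->
  a (M - j) - a M <= 2 * a M / M%:R * (j%:R * (j.+1)%:R).
Proof.
move=> M0 jM; have m0 : 0 < M%:R :> R by rewrite ltr0n.
have aM := invsqrt_coef_gt0 R M.
suff : M%:R * (a (M - j) - a M) <= 2 * a M * (j%:R * (j.+1)%:R).
  by move=> s; rewrite [leRHS]mulrAC ler_pdivlMr // [leLHS]mulrC.
have [ltjM|leMj] := ltnP j M; last first.
  have -> : j = M by apply/eqP; rewrite eqn_leq jM.
  rewrite subnn; have : 1%:R * a 1 <= M%:R * a M by exact: mul_invsqrt_coef_incr.
  have -> : a 1 = 2^-1 by have := invsqrt_coefS R 0; rewrite mul1r add0r mulr1.
  rewrite -[a 0]/(1 : R) -[M.+1]addn1 natrD.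
  by move: (a M) aM (M%:R : R) m0 => u u0 x x0; nra.
have k0 : 0 < (M - j)%:R :> R by rewrite ltr0n subn_gt0.
have k1 : 1 <= (M - j)%:R :> R by rewrite ler1n subn_gt0.
have := mul_invsqrt_coef_incr (leq_subr j M).
have -> : M%:R = (M - j)%:R + j%:R :> R by rewrite -natrD subnK.
have := invsqrt_coef_gt0 R (M - j); have : 0 <= j%:R :> R by exact: ler0n.
rewrite -[j.+1]addn1 natrD.
move: (a M) aM (a (M - j)) ((M - j)%:R : R) k0 k1 (j%:R : R) => u u0 v k k0 k1 x x0 v0 h.
rewrite -(ler_pM2l k0).
have h2 : (k + x) * (k * v) <= (k + x) * ((k + x) * u) by rewrite ler_wpM2l //; lra.
have h3 : x * (k + x) <= 2 * k * (x * (x + 1)) by nra.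
have h4 : u * (x * (k + x)) <= u * (2 * k * (x * (x + 1))) by rewrite ler_wpM2l // ltW.
lra.
Qed.

(** For [y = a M * r] and [e = 1 / (2M)], Wallis' bounds read [y^2 <= 1 <= y^2 (1 + e)]; hence
    [y >= y^2 >= 1 - e]. *)
Lemma invsqrt_coef_asymptotic M : (0 < M)%N ->
  let r : R := Num.sqrt (pi * M%:R) in
  a M <= r^-1 /\ r^-1 - a M <= r^-1 / (2 * M%:R).
Proof.
case: M => // m _ r; set M := m.+1.
have M0 : 0 < M%:R :> R by rewrite ltr0n.
have pM : 0 < pi * M%:R :> R by rewrite mulr_gt0 // pi_gt0.
have r0 : 0 < r by rewrite sqrtr_gt0.
have r2 : r ^+ 2 = pi * M%:R by rewrite sqr_sqrtr // ltW.
have up := wallis_upper R m; have lo := wallis_lower R M.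
have aM := invsqrt_coef_gt0 R M.
have e0 : 0 < (2 * M%:R : R)^-1 by rewrite invr_gt0 mulr_gt0.
have y2 : (a M * r) ^+ 2 <= 1 by rewrite exprMn r2 mulrC.
have y2' : 1 <= (a M * r) ^+ 2 * (1 + (2 * M%:R)^-1).
  rewrite exprMn r2; apply: le_trans lo _; rewrite le_eqVlt; apply/orP; left; apply/eqP.
  by field; exact: lt0r_neq0.
have y0 : 0 < a M * r by exact: mulr_gt0.
have y1 : a M * r <= 1 by move: (a M * r) y0 y2 => y; nra.
have low : 1 - (2 * M%:R)^-1 <= a M * r.
  by move: (a M * r) ((2 * M%:R)^-1) y0 y1 y2 y2' e0 => y e; nra.
split; first by rewrite -[r^-1]mul1r ler_pdivlMr.
have rr : r^-1 * r = 1 by rewrite mulVf // lt0r_neq0.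
rewrite -(ler_pM2r r0) mulrBl rr [leRHS]mulrAC rr mul1r.
by move: low; lra.
Qed.

Variable h : nat -> R.
Hypothesis hPi : forall n, (0 < n)%N -> eqX n.+1 (hpoly h n * (1 - 'X))
    (\prod_(w <- places n) (1 - (2^-1 * 2^-1 ^+ degw w)%:P * 'X^(degw w))).

Lemma glim_ge0 : 0 <= glim h.
Proof.
apply: le_trans (gsum_le_glim hPi 0); rewrite /gsum sumr_ge0 // => j _.
exact: gcoef_ge0.
Qed.

Lemma h_close M : (0 < M)%N -> `|h M - glim h * a M| <= 192 * Gbound R * (a M / M%:R).
Proof.
move=> M0; have m0 : 0 < M%:R :> R by rewrite ltr0n.
have aM := invsqrt_coef_gt0 R M; have g0 := gcoef_ge0 hPi.
have G0 := Gbound_gt0 R.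
pose D := \sum_(j < M.+1) gcoef h j * (a (M - j) - a M).
have hE : h M - glim h * a M = D - a M * (glim h - gsum h M).
  rewrite (h_conv h) /D; under [in RHS]eq_bigr do rewrite mulrBr.
  by rewrite sumrB -mulr_suml -/(gsum h M); ring.
have D0 : 0 <= D.
  apply: sumr_ge0 => j _; rewrite mulr_ge0 // subr_ge0.
  by apply: invsqrt_coef_decr; exact: leq_subr.
(* [128 = 2 * 64], from [invsqrt_coef_shift] and [quadratic_le_pow]; the tail below adds another
   [64]. *)
have D1 : D <= 128 * Gbound R * (a M / M%:R).
  apply: (@le_trans _ _ (\sum_(j < M.+1) 128 * (a M / M%:R) * (gcoef h j * (5 / 4) ^+ j))).
    apply: ler_sum => j _; rewrite mulrCA; apply: (ler_wpM2l (g0 j)).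
    have jM : (j <= M)%N by rewrite -ltnS.
    apply: le_trans (invsqrt_coef_shift M0 jM) _.
    have q := quadratic_le_pow R j.
    have c0 : 0 <= 2 * a M / M%:R by rewrite divr_ge0 ?mulr_ge0 // ltW.
    apply: le_trans (ler_wpM2l c0 q) _; rewrite le_eqVlt; apply/orP; left; apply/eqP; ring.
  rewrite -mulr_sumr [leRHS]mulrAC ler_wpM2l //; last exact: gcoef_weighted.
  by rewrite mulr_ge0 // divr_ge0 // ltW.
have T0 : 0 <= glim h - gsum h M by rewrite subr_ge0; exact: gsum_le_glim.
have T1 : glim h - gsum h M <= 64 * Gbound R / M%:R.
  have := glim_tail hPi M; rewrite -lerBlDl => /le_trans; apply.
  rewrite -mulrA mulrCA; apply: (ler_wpM2l (ltW G0)); rewrite ler_pdivlMr // exprS.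
  have y0 : 0 <= (4 / 5 : R) ^+ M by apply: exprn_ge0; lra.
  have yq : (5 / 4) ^+ M * (4 / 5) ^+ M = 1 :> R.
    by rewrite -exprMn (_ : 5 / 4 * (4 / 5) = 1 :> R) ?expr1n //; field.
  have := ler_wpM2r y0 (quadratic_le_pow R M); rewrite -[leRHS]mulrA yq -[M.+1]addn1 natrD.
  by move: ((4 / 5) ^+ M) (M%:R : R) y0 m0 => y x; nra.
rewrite hE; apply: le_trans (ler_normB _ _) _; rewrite ger0_norm // ger0_norm; last first.
  by rewrite mulr_ge0 // ltW.
apply: le_trans (lerD D1 (ler_wpM2l (ltW aM) T1)) _.
rewrite le_eqVlt; apply/orP; left; apply/eqP; field.
exact: lt0r_neq0.
Qed.

Lemma h_asymptotic M : (0 < M)%N ->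
  `|h M - glim h / Num.sqrt (pi * M%:R)|
    <= (192 * Gbound R + glim h) / (M%:R * Num.sqrt (pi * M%:R)).
Proof.
move=> M0; have m0 : 0 < M%:R :> R by rewrite ltr0n.
have r0 : 0 < Num.sqrt (pi * M%:R) :> R by rewrite sqrtr_gt0 mulr_gt0 // pi_gt0.
have [u1 u2] := invsqrt_coef_asymptotic M0; have G0 := Gbound_gt0 R.
move: (Num.sqrt _) r0 u1 u2 => r r0 u1 u2.
have -> : h M - glim h / r = (h M - glim h * a M) - glim h * (r^-1 - a M) by ring.
apply: le_trans (ler_normB _ _) _.
rewrite [`|glim h * _|]ger0_norm; last by rewrite mulr_ge0 ?glim_ge0 // subr_ge0.
have t1 : `|h M - glim h * a M| <= 192 * Gbound R * (r^-1 / M%:R).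
  apply: le_trans (h_close M0) _; rewrite ler_wpM2l ?ler_wpM2r ?invr_ge0 ?mulr_ge0 // ltW //.
have t2 : glim h * (r^-1 - a M) <= glim h * (r^-1 / M%:R).
  apply: (ler_wpM2l glim_ge0); apply: le_trans u2 _.
  rewrite ler_wpM2l ?invr_ge0 ?(ltW r0) // lef_pV2 ?posrE ?mulr_gt0 //; lra.
apply: le_trans (lerD t1 t2) _; rewrite le_eqVlt; apply/orP; left; apply/eqP; field.
by rewrite !lt0r_neq0.
Qed.

End Asymptotics.

Theorem theorem1p1 (R : realType) :
  exists L : R, cpart R n @[n --> \oo] --> L /\
  let c : R := 4 * (2 * ln 2 / pi) `^ (2^-1) * L in
  exists (C : R) (M0 : nat), forall M : nat, (M0 <= M)%N ->
    let B : R := 2 ^+ M in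
    `| Ncount R M - c * B ^+ 2 / (ln B) `^ (2^-1) |
      <= C * (B ^+ 2 / (ln B) `^ (3 / 2)).
Proof.
pose h := hnorm R (@FracField.tofrac {poly 'F_2}).
have hPi n : (0 < n)%N -> eqX n.+1 (hpoly h n * (1 - 'X))
    (\prod_(w <- places n) (1 - (2^-1 * 2^-1 ^+ degw w)%:P * 'X^(degw w))).
  exact: (generating_function R iotaK_inj iotaK_frac).
exists (Num.sqrt 2^-1 / 2 * (2^-1 * glim h)); split.
  have c1 : Num.sqrt 2^-1 / 2 * (\prod_(w <- places n) (1 - 4^-1 ^+ degw w) * half_product R n)
      @[n --> \oo] --> Num.sqrt 2^-1 / 2 * (2^-1 * glim h).
    apply: cvgM; first exact: cvg_cst.
    by apply: cvgM; [exact: zeta2_cvg | exact: half_product_cvg].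
  apply: cvg_trans c1; apply: near_eq_cvg; exists 1%N => // n /= n0.
  by rewrite cpartE.
move=> c; pose K0 := 192 * Gbound R + glim h.
(* [(ln 2)^(3/2)] converts [M^(3/2)] into [(ln B)^(3/2)]; [sqrt pi] comes from the central binomial
   coefficients. *)
exists (K0 * (ln 2 * Num.sqrt (ln 2)) / Num.sqrt pi), 1%N => M M0; cbv zeta; set B : R := 2 ^+ M.
have l2 : 0 < ln 2 :> R by rewrite ln_gt0 // ltr1n.
have m0 : 0 < M%:R :> R by rewrite ltr0n.
have p0 : 0 < pi :> R := pi_gt0 R.
have lnB : ln B = M%:R * ln 2 by rewrite /B lnXn // mulr_natl.
have lB0 : 0 < ln B by rewrite lnB mulr_gt0.
have B2 : B ^+ 2 = 4 ^+ M by rewrite /B -exprM mulnC exprM; congr (_ ^+ _); ring.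
have NE : Ncount R M = 4 ^+ M * h M.
  by rewrite NcountE // /h /hnorm mulrC divfK // expf_neq0 // pnatr_eq0.
have hp : (ln B) `^ (3 / 2) = ln B * Num.sqrt (ln B).
  rewrite (_ : 3 / 2 = 1 + 2^-1); last by field.
  rewrite powRD; last by apply/implyP => _; exact: lt0r_neq0.
  by rewrite powRr1 ?powR12_sqrt // ltW.
rewrite hp B2 NE powR12_sqrt; last exact: ltW.
rewrite /c powR12_sqrt; last by rewrite divr_ge0 ?mulr_ge0 // ltW.
have := h_asymptotic hPi M0; rewrite -/K0 lnB.
rewrite !sqrtrM ?sqrtrV ?mulr_ge0 ?(ltW l2) ?(ltW m0) ?(ltW p0) //.
have : 0 < Num.sqrt M%:R :> R by rewrite sqrtr_gt0.
have : 0 < Num.sqrt (ln 2) :> R by rewrite sqrtr_gt0.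
have : 0 < Num.sqrt pi :> R by rewrite sqrtr_gt0.
have : 0 < Num.sqrt 2 :> R by rewrite sqrtr_gt0.
move: (Num.sqrt 2) (Num.sqrt pi) (Num.sqrt (ln 2)) (Num.sqrt M%:R) => s2 sp sl sM.
move=> h1 h2 h3 h4 H.
have f0 : 0 < 4 ^+ M :> R by rewrite exprn_gt0.
(* The numerical factors cancel: [4 * sqrt 2 * 1 / (2 sqrt 2) * 1/2 = 1]. *)
have -> : 4 ^+ M * h M - 4 * (s2 * sl / sp) * (s2^-1 / 2 * (2^-1 * glim h)) * 4 ^+ M / (sM * sl)
    = 4 ^+ M * (h M - glim h / (sp * sM)).
  by field; rewrite !lt0r_neq0.
rewrite normrM (gtr0_norm f0).
apply: le_trans (ler_wpM2l (ltW f0) H) _.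
rewrite le_eqVlt; apply/orP; left; apply/eqP; field.
by rewrite !lt0r_neq0.
Qed.
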